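(* Let $F$ be a field of arbitrary characteristic. The category of alternative $M_2$-algebras over $F$ is isomorphic to the category of $\Gamma$-algebras over $F$.
   Context: Algebras are not assumed associative; $[a,b]=ab-ba$, $(a,b,c)=(ab)c-a(bc)$, and $Z(\cdot)$ denotes the center. A $\Gamma$-algebra is a $\mathbb Z_2$-graded $F$-algebra $\Gamma=\Gamma_0\oplus\Gamma_1$ such that: (i) $\Gamma_0$ is a unital associative algebra (whose identity is the identity of $\Gamma$), $[\Gamma_0,\Gamma_1]=0$ and $(\Gamma_0,\Gamma,\Gamma)=0$ (associators whose first entry is in $\Gamma_0$ vanish); (ii) $\Gamma_1^2\subseteq Z(\Gamma_0)$; (iii) $xy+yx=0$ for $x,y\in\Gamma_1$; (iv) $(xy)z+(yz)x+(zx)y=0$ for $x,y,z\in\Gamma_1$. Morphisms of $\Gamma$-algebras are unital algebra homomorphisms preserving the grading. An alternative $M_2$-algebra is a unital alternative $F$-algebra $A$ with a homomorphism of unital algebras $\phi_A:M_2(F)\to A$. Morphisms $A\to A'$ of $M_2$-algebras are unital algebra homomorphisms $f$ that are identical on $M_2(F)$, i.e. $f\circ\phi_A=\phi_{A'}$.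
   Formalization: In characteristic 2, Γ-algebras are also required to satisfy xx=0 for x in Γ_1 (with only xy+yx=0 the claim fails, e.g. over F_2); ''isomorphic'' is proved as an equivalence for all algebras and as an isomorphism for algebras on subsets of any infinite set. *)

(* Defs.v *)
From mathcomp Require Import all_boot all_algebra.
From mathcomp Require Import boolp classical_sets cardinality.

Set Implicit Arguments.
Unset Strict Implicit.
Unset Printing Implicit Defensive.

Import GRing.Theory.

(* Unital F-algebras, not assumed associative or commutative, on a carrier T.
   The vector space structure is spelled out rather than taken from [lmodType]
   so that an algebra carries no choice operator or decidable equality: two
   algebras on T with the same operations are equal, which matters when
   categories are compared up to isomorphism and not only up to equivalence.
   The zero algebra (1 = 0) is allowed. *)
Record algebra (F : fieldType) (T : Type) := Algebra {
  azero : T;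
  aopp : T -> T;
  aadd : T -> T -> T;
  ascale : F -> T -> T;
  aone : T;
  amul : T -> T -> T;
  aaddA : associative aadd;
  aaddC : commutative aadd;
  aadd0 : left_id azero aadd;
  aaddN : left_inverse azero aopp aadd;
  ascaleA : forall a b x, ascale a (ascale b x) = ascale (a * b)%R x;
  ascale1 : forall x, ascale 1%R x = x;
  ascaleDr : forall a x y, ascale a (aadd x y) = aadd (ascale a x) (ascale a y);
  ascaleDl : forall a b x, ascale (a + b)%R x = aadd (ascale a x) (ascale b x);
  amul1l : left_id aone amul;
  amul1r : right_id aone amul;
  amulDl : left_distributive amul aadd;
  amulDr : right_distributive amul aadd;
  amulZl : forall a x y, amul (ascale a x) y = ascale a (amul x y);
  amulZr : forall a x y, amul x (ascale a y) = ascale a (amul x y)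
}.

Definition mx2_algebra (F : fieldType) : algebra F 'M[F]_2.
Proof.
refine (@Algebra F 'M[F]_2 0%R -%R%R +%R%R *:%R%R 1%:M%R (@mulmx F 2 2 2)
          (@addrA _) (@addrC _) (@add0r _) (@addNr _)
          (@scalerA _ _) (@scale1r _ _) (@scalerDr _ _) _
          (@mul1mx _ _ _) (@mulmx1 _ _ _) _ _ _ _).
- by move=> a b x; rewrite scalerDl.
- by move=> x y z; rewrite mulmxDl.
- by move=> x y z; rewrite mulmxDr.
- by move=> a x y; rewrite scalemxAl.
- by move=> a x y; rewrite scalemxAr.
Defined.

Section AlgebraTheory.

Variables (F : fieldType) (T : Type) (A : algebra F T).

Definition asub (x y : T) : T := aadd A x (aopp A y).

Definition commutator (x y : T) : T := asub (amul A x y) (amul A y x).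

Definition associator (x y z : T) : T :=
  asub (amul A (amul A x y) z) (amul A x (amul A y z)).

(* The center of the subalgebra S: the elements of S that commute and
   associate with all elements of S. *)
Definition center (S : set T) : set T := fun z =>
  S z /\
  (forall x, S x -> commutator z x = azero A) /\
  (forall x y, S x -> S y ->
     associator z x y = azero A /\
     associator x z y = azero A /\
     associator x y z = azero A).

Definition alternative : Prop := forall x y,
  associator x x y = azero A /\ associator y x x = azero A.

Record is_subspace (S : set T) : Prop := IsSubspace {
  subspace0 : S (azero A);
  subspaceD : forall x y, S x -> S y -> S (aadd A x y);
  subspaceZ : forall a x, S x -> S (ascale A a x)
}.

End AlgebraTheory.

Record is_unital_hom (F : fieldType) (T T' : Type) (A : algebra F T)
    (A' : algebra F T') (f : T -> T') : Prop := IsUnitalHom {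
  homD : forall x y, f (aadd A x y) = aadd A' (f x) (f y);
  homZ : forall a x, f (ascale A a x) = ascale A' a (f x);
  homM : forall x y, f (amul A x y) = amul A' (f x) (f y);
  hom1 : f (aone A) = aone A'
}.

Record M2_algebra (F : fieldType) (T : Type) := M2Algebra {
  M2_alg :> algebra F T;
  M2_alternative : alternative M2_alg;
  M2_phi : 'M[F]_2 -> T;
  M2_phi_hom : is_unital_hom (mx2_algebra F) M2_alg M2_phi
}.

(* Z_2 is [bool] with [(+)]: Gamma_0 is [gpart false], Gamma_1 [gpart true].
   [gamma_odd_center] speaks of products only; this is the inclusion of the
   span of Gamma_1 Gamma_1, since the center is a subspace.
   [gamma_odd_alt] makes the skew-symmetric product on Gamma_1 alternating in
   characteristic 2; in every other characteristic its premise is false (and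
   its conclusion follows from [gamma_odd_skew]).  Without it the algebra with
   Gamma_0 = F[e]/(e^2), Gamma_1 = F x, x x = e, e x = x e = 0 over a field of
   characteristic 2 would qualify, but it corresponds to no alternative algebra
   containing M_2(F): there the product on Gamma_1 is always alternating. *)
Record gamma_algebra (F : fieldType) (T : Type) := GammaAlgebra {
  gamma_alg :> algebra F T;
  gpart : bool -> set T;
  gpart_subspace : forall i, is_subspace gamma_alg (gpart i);
  gpart_sum : forall x, exists x0 x1,
    gpart false x0 /\ gpart true x1 /\ x = aadd gamma_alg x0 x1;
  gpart_direct : forall x, gpart false x -> gpart true x ->
    x = azero gamma_alg;
  gpart_mul : forall i j x y, gpart i x -> gpart j y ->
    gpart (i (+) j) (amul gamma_alg x y);
  gamma_even1 : gpart false (aone gamma_alg);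
  gamma_even_assoc : forall a b c,
    gpart false a -> gpart false b -> gpart false c ->
    associator gamma_alg a b c = azero gamma_alg;
  gamma_even_odd_comm : forall a x, gpart false a -> gpart true x ->
    commutator gamma_alg a x = azero gamma_alg;
  gamma_even_nucl : forall a x y, gpart false a ->
    associator gamma_alg a x y = azero gamma_alg;
  gamma_odd_center : forall x y, gpart true x -> gpart true y ->
    center gamma_alg (gpart false) (amul gamma_alg x y);
  gamma_odd_skew : forall x y, gpart true x -> gpart true y ->
    aadd gamma_alg (amul gamma_alg x y) (amul gamma_alg y x) = azero gamma_alg;
  gamma_odd_alt : 2%N \in [pchar F]%R -> forall x, gpart true x ->
    amul gamma_alg x x = azero gamma_alg;
  gamma_odd_cyclic : forall x y z,
    gpart true x -> gpart true y -> gpart true z ->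
    aadd gamma_alg
      (aadd gamma_alg (amul gamma_alg (amul gamma_alg x y) z)
                      (amul gamma_alg (amul gamma_alg y z) x))
      (amul gamma_alg (amul gamma_alg z x) y) = azero gamma_alg
}.

Definition is_M2_hom (F : fieldType) (T T' : Type) (A : M2_algebra F T)
    (A' : M2_algebra F T') (f : T -> T') : Prop :=
  is_unital_hom A A' f /\ f \o M2_phi A = M2_phi A'.

Definition is_gamma_hom (F : fieldType) (T T' : Type) (G : gamma_algebra F T)
    (G' : gamma_algebra F T') (f : T -> T') : Prop :=
  is_unital_hom G G' f /\ forall i x, gpart G i x -> gpart G' i (f x).

Record category := Category {
  ob : Type;
  hom : ob -> ob -> Type;
  idm : forall X, hom X X;
  comp : forall X Y Z, hom Y Z -> hom X Y -> hom X Z;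
  comp1m : forall X Y (f : hom X Y), comp (idm Y) f = f;
  compm1 : forall X Y (f : hom X Y), comp f (idm X) = f;
  compA : forall X Y Z W (h : hom Z W) (g : hom Y Z) (f : hom X Y),
    comp h (comp g f) = comp (comp h g) f
}.

Record functor (C D : category) := Functor {
  fob :> ob C -> ob D;
  fmap : forall X Y, hom X Y -> hom (fob X) (fob Y);
  fmap1 : forall X, fmap (idm X) = idm (fob X);
  fmapM : forall X Y Z (g : hom Y Z) (f : hom X Y),
    fmap (comp g f) = comp (fmap g) (fmap f)
}.

Definition functor_id (C : category) : functor C C.
Proof. by refine (@Functor C C id (fun _ _ f => f) _ _). Defined.

Definition functor_comp (C D E : category) (K : functor D E) (L : functor C D) :
  functor C E.
Proof.
refine (@Functor C E (fun X => K (L X)) (fun _ _ f => fmap K (fmap L f)) _ _).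
- by move=> X; rewrite !fmap1.
- by move=> X Y Z g f; rewrite !fmapM.
Defined.

Definition naturally_isomorphic (C D : category) (K L : functor C D) : Prop :=
  exists (eta : forall X, hom (K X) (L X)) (theta : forall X, hom (L X) (K X)),
    (forall X, comp (theta X) (eta X) = idm (K X)) /\
    (forall X, comp (eta X) (theta X) = idm (L X)) /\
    (forall X Y (f : hom X Y), comp (eta Y) (fmap K f) = comp (fmap L f) (eta X)).

Definition equivalent_categories (C D : category) : Prop :=
  exists (K : functor C D) (L : functor D C),
    naturally_isomorphic (functor_comp L K) (functor_id C) /\
    naturally_isomorphic (functor_comp K L) (functor_id D).

(* An isomorphism of categories: a functor that is bijective both on objects
   and on arrows. *)
Definition isomorphic_categories (C D : category) : Prop :=
  exists K : functor C D,
    bijective (fob K) /\ forall X Y, bijective (@fmap C D K X Y).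

(* The categories of algebras whose carriers are taken from a family [El] of
   types. *)
Section Categories.

Variables (F : fieldType) (I : Type) (El : I -> Type).

Record M2_object := M2Object {
  M2_index : I;
  M2_str :> M2_algebra F (El M2_index)
}.

Record gamma_object := GammaObject {
  gamma_index : I;
  gamma_str :> gamma_algebra F (El gamma_index)
}.

Definition M2_hom (A B : M2_object) := {f | is_M2_hom A B f}.

Definition gamma_hom (G H : gamma_object) := {f | is_gamma_hom G H f}.

Lemma is_M2_hom_id (A : M2_object) : is_M2_hom A A id.
Proof. by []. Qed.

Lemma is_M2_hom_comp (A B C : M2_object) g f :
  is_M2_hom B C g -> is_M2_hom A B f -> is_M2_hom A C (g \o f).
Proof.
move=> [[gD gZ gM g1] gp] [[fD fZ fM f1] fp]; split.
  by split=> *; rewrite /= ?fD ?fZ ?fM ?f1.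
by rewrite -gp -fp.
Qed.

Lemma is_gamma_hom_id (G : gamma_object) : is_gamma_hom G G id.
Proof. by []. Qed.

Lemma is_gamma_hom_comp (A B C : gamma_object) g f :
  is_gamma_hom B C g -> is_gamma_hom A B f -> is_gamma_hom A C (g \o f).
Proof.
move=> [[gD gZ gM g1] gp] [[fD fZ fM f1] fp]; split.
  by split=> *; rewrite /= ?fD ?fZ ?fM ?f1.
by move=> i x /fp /gp.
Qed.

Definition M2_category : category.
Proof.
refine (@Category M2_object M2_hom
  (fun A => exist _ id (is_M2_hom_id A))
  (fun A B C g f => exist _ (sval g \o sval f)
                      (is_M2_hom_comp (proj2_sig g) (proj2_sig f))) _ _ _).
- by move=> A B [f Hf]; apply: eq_exist.
- by move=> A B [f Hf]; apply: eq_exist.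
- by move=> A B C D [h Hh] [g Hg] [f Hf]; apply: eq_exist.
Defined.

Definition gamma_category : category.
Proof.
refine (@Category gamma_object gamma_hom
  (fun G => exist _ id (is_gamma_hom_id G))
  (fun A B C g f => exist _ (sval g \o sval f)
                      (is_gamma_hom_comp (proj2_sig g) (proj2_sig f))) _ _ _).
- by move=> A B [f Hf]; apply: eq_exist.
- by move=> A B [f Hf]; apply: eq_exist.
- by move=> A B C D [h Hh] [g Hg] [f Hf]; apply: eq_exist.
Defined.

End Categories.

Definition M2_algebras (F : fieldType) : category :=
  M2_category F (fun T : Type => T).

Definition gamma_algebras (F : fieldType) : category :=
  gamma_category F (fun T : Type => T).

(* Algebras whose underlying set is a subset of U.  Types, unlike sets, cannot
   be shown to have distinct copies, so an isomorphism (rather than an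
   equivalence) of categories of algebras is only meaningful once the
   underlying sets are subsets of some universe of elements U. *)
Definition M2_algebras_in (F : fieldType) (U : Type) : category :=
  M2_category F (fun X : set U => set_type X).

Definition gamma_algebras_in (F : fieldType) (U : Type) : category :=
  gamma_category F (fun X : set U => set_type X).

(* Main.v *)
Require Import Defs.
From mathcomp Require Import all_boot all_algebra.
From mathcomp Require Import boolp classical_sets cardinality.
From mathcomp Require Import functions ring.

Set Implicit Arguments.
Unset Strict Implicit.
Unset Printing Implicit Defensive.

Import GRing.Theory.

(** Let [H] be the image of the 2 x 2 matrices in an alternative algebra [A],
    with matrix units [e_ij], and write [h'] for the adjugate of a matrix [h].
    As a bimodule over the quaternion algebra [H], [A] is the sum of
      - [N], the elements whose associators with two matrices vanish, and
      - [J], the elements [w] with [h w = w h'] for all [h];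
    the projection onto [J] comes from the associators [(u, e01, e10)], which lie
    in [J] ([assoc_conj_decomp]).  Expanding [n] in [N] by matrix units writes
    [N] as [C H], where [C] is the centralizer of [H], so the coordinates of
    [A] are four elements of [C] and, for [J], two elements of the odd part
    [J e00]: every [w] in [J] is [x + y e10] with [x], [y] in [J e00].

    The multiplication is then forced.  [C] lies in the nucleus
    ([cent_nucleus]); the starting point is that an associator [(c, e, u)] with
    [e] an idempotent commuting with [c] is zero ([idempotent_assoc]), and the
    matrices are spanned by idempotents.  For [w], [v] in [J] one has
    [(w h) k = w (k h)], [w (v h) = h (w v)] and [(w h) v = (w v) h'], so that
    the product of two elements of [J] is determined by the products [x y] of
    odd elements.  Those have the form [c e01] with [c] in [C], and sending
    [(x, y)] to [c] makes [C + J e00] a Gamma-algebra, [gamma_of].  Its cyclic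
    identity is the rotation invariance of the associator of [x], [y] and
    [z e10].  Conversely the same formulas make 2 x 2 matrices over the even part
    plus columns over the odd part of a Gamma-algebra an alternative algebra,
    [zorn_M2]; its alternativity amounts to identities of degree three, which
    are decided by comparing normal forms.  The two constructions are inverse to
    each other ([coordinatize], [recover]), and as every element is assembled
    from [C], [J e00] and [H], homomorphisms of [A] over [H] are the same as
    homomorphisms of the Gamma-algebra.  So [gamma_of] is fully faithful and
    essentially surjective, which is the equivalence.

    For the isomorphism of categories of algebras on subsets of an infinite [U]
    it remains to choose a bijection between the objects that sends each [A] to a
    copy of [gamma_of A]; full faithfulness does the rest.  By the argument of
    Schroeder and Bernstein an injection in each direction suffices.  An algebra
    [A] in a given isomorphism class amounts to an embedding into [U] of a
    representative of the class, up to automorphisms.  Such an embedding can be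
    coded by a subset of [U] of the cardinality of the Gamma-algebra, because [A]
    and its Gamma-algebra are both finite or equinumerous
    ([gamma_of_card]) and [U * U] embeds into [U] ([square_injection]).  Naming a
    copy of the Gamma-algebra by that subset gives the injection
    ([object_injection]); the other direction is symmetric. *)

(** * Calculation in nonassociative algebras *)

Section Calculus.

Variables (F : fieldType) (T : Type) (A : algebra F T).

Local Notation "0" := (azero A).
Local Notation "1" := (aone A).
Local Notation "- x" := (aopp A x).
Local Notation "x + y" := (aadd A x y).
Local Notation "x - y" := (asub A x y).
Local Notation "x * y" := (amul A x y).
Local Notation "a *: x" := (ascale A a x).

Lemma aaddr0 x : x + 0 = x.
Proof. by rewrite aaddC aadd0. Qed.

Lemma aaddrN x : x + - x = 0.
Proof. by rewrite aaddC aaddN. Qed.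

Lemma aaddI x y z : x + y = x + z -> y = z.
Proof. by move=> e; rewrite -(aadd0 A y) -(aaddN A x) -aaddA e aaddA aaddN aadd0. Qed.

Lemma aoppP x y : x + y = 0 -> y = - x.
Proof. by move=> e; apply: (@aaddI x); rewrite e aaddrN. Qed.

Lemma aoppK x : - - x = x.
Proof. by apply/esym/aoppP; rewrite aaddN. Qed.

Lemma aopp0 : - 0 = 0.
Proof. by apply/esym/aoppP; rewrite aadd0. Qed.

Lemma aaddCA x y z : x + (y + z) = y + (x + z).
Proof. by rewrite !aaddA (aaddC A x). Qed.

Lemma aoppD x y : - (x + y) = - x + - y.
Proof.
by apply/esym/aoppP; rewrite (aaddC A x) aaddA -(aaddA A y) aaddrN aaddr0 aaddrN.
Qed.

Lemma asub_eq0 x y : x - y = 0 <-> x = y.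
Proof.
split=> [e|->]; last exact: aaddrN.
by rewrite -[x]aaddr0 -(aaddN A y) aaddA -/(asub A x y) e aadd0.
Qed.

Lemma amul0r x : 0 * x = 0.
Proof. by apply: (@aaddI (0 * x)); rewrite -amulDl aadd0 aaddr0. Qed.

Lemma amulr0 x : x * 0 = 0.
Proof. by apply: (@aaddI (x * 0)); rewrite -amulDr aadd0 aaddr0. Qed.

Lemma amulNl x y : - x * y = - (x * y).
Proof. by apply: aoppP; rewrite -amulDl aaddrN amul0r. Qed.

Lemma amulNr x y : x * - y = - (x * y).
Proof. by apply: aoppP; rewrite -amulDr aaddrN amulr0. Qed.

Lemma ascaler0 a : a *: 0 = 0.
Proof. by apply: (@aaddI (a *: 0)); rewrite -ascaleDr aadd0 aaddr0. Qed.

Lemma ascale0r x : 0%R *: x = 0.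
Proof. by apply: (@aaddI (0%R *: x)); rewrite -ascaleDl addr0 aaddr0. Qed.

Lemma ascalerN a x : a *: - x = - (a *: x).
Proof. by apply: aoppP; rewrite -ascaleDr aaddrN ascaler0. Qed.

Lemma ascaleN1 x : (-1)%R *: x = - x.
Proof. by apply: aoppP; rewrite -[X in X + _](ascale1 A) -ascaleDl subrr ascale0r. Qed.

Lemma subspaceN (S : set T) x : is_subspace A S -> S x -> S (- x).
Proof. by move=> sS Sx; rewrite -ascaleN1; apply: subspaceZ. Qed.

(** A decision procedure for the identities of the free nonassociative ring:
    both sides are expanded to signed sums of monomials, which must cancel in
    pairs.  The parameter [nf] of the section below lets the same procedure
    decide identities in a smaller variety, by rewriting every monomial to a
    normal form first. *)
Inductive expr :=
  | Var of nat | Zero | One | Add of expr & expr | Opp of expr | Mul of expr & expr.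

Inductive mono := MOne | MVar of nat | MMul of mono & mono.

Fixpoint mono_eqb (s t : mono) : bool :=
  match s, t with
  | MOne, MOne => true
  | MVar i, MVar j => i == j
  | MMul s1 s2, MMul t1 t2 => mono_eqb s1 t1 && mono_eqb s2 t2
  | _, _ => false
  end.

Lemma mono_eqbP s t : mono_eqb s t -> s = t.
Proof.
elim: s t => [|i|s1 IH1 s2 IH2] [|j|t1 t2] //= => [/eqP->//|].
by move=> /andP[/IH1-> /IH2->].
Qed.

Definition poly_mono := seq (bool * mono).

Definition mmul (s t : mono) : mono :=
  match s, t with MOne, _ => t | _, MOne => s | _, _ => MMul s t end.

Definition popp (p : poly_mono) : poly_mono := [seq (~~ m.1, m.2) | m <- p].

Definition pmul (p q : poly_mono) : poly_mono :=
  flatten [seq [seq (m.1 (+) n.1, mmul m.2 n.2) | n <- q] | m <- p].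

Fixpoint expand (e : expr) : poly_mono :=
  match e with
  | Var i => [:: (false, MVar i)]
  | Zero => [::]
  | One => [:: (false, MOne)]
  | Add e1 e2 => expand e1 ++ expand e2
  | Opp e1 => popp (expand e1)
  | Mul e1 e2 => pmul (expand e1) (expand e2)
  end.

Fixpoint extract (b : bool) (s : mono) (p : poly_mono) : option poly_mono :=
  if p is (c, t) :: p' then
    if (b == c) && mono_eqb s t then Some p'
    else omap (cons (c, t)) (extract b s p')
  else None.

Fixpoint cancels (n : nat) (p : poly_mono) : bool :=
  match n, p with
  | _, [::] => true
  | n'.+1, (b, s) :: p' =>
      if extract (~~ b) s p' is Some q then cancels n' q else false
  | _, _ => false
  end.

Section Eval.

Variable env : nat -> T.

Fixpoint eval (e : expr) : T :=
  match e with
  | Var i => env i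
  | Zero => 0
  | One => 1
  | Add e1 e2 => eval e1 + eval e2
  | Opp e1 => - eval e1
  | Mul e1 e2 => eval e1 * eval e2
  end.

Fixpoint meval (s : mono) : T :=
  match s with
  | MOne => 1
  | MVar i => env i
  | MMul s1 s2 => meval s1 * meval s2
  end.

Definition seval (m : bool * mono) : T := if m.1 then - meval m.2 else meval m.2.

Definition peval (p : poly_mono) : T := foldr (fun m x => seval m + x) 0 p.

Lemma peval_cat p q : peval (p ++ q) = peval p + peval q.
Proof. by elim: p => [|m p IH] /=; rewrite ?aadd0 // IH aaddA. Qed.

Lemma seval_opp b s : seval (~~ b, s) = - seval (b, s).
Proof. by case: b; rewrite /seval /= ?aoppK. Qed.

Lemma peval_opp p : peval (popp p) = - peval p.
Proof. by elim: p => [|[b s] p IH] /=; rewrite ?aopp0 // IH seval_opp aoppD. Qed.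

Lemma meval_mul s t : meval (mmul s t) = meval s * meval t.
Proof. by case: s => [|i|s1 s2]; case: t => [|j|t1 t2] /=; rewrite ?amul1l ?amul1r. Qed.

Lemma peval_mul p q : peval (pmul p q) = peval p * peval q.
Proof.
elim: p => [|m p IHp]; first by rewrite amul0r.
rewrite /pmul /= peval_cat amulDl -IHp; congr (_ + _).
elim: q {IHp} => [|n q IHq] /=; first by rewrite amulr0.
rewrite amulDr -IHq; congr (_ + _); case: m {IHq} n => [[] s] [[] t];
  by rewrite /seval /= meval_mul ?amulNl ?amulNr ?aoppK.
Qed.

Lemma peval_expand e : peval (expand e) = eval e.
Proof.
elim: e => [i|||e1 IH1 e2 IH2|e IH|e1 IH1 e2 IH2] /=; rewrite ?aaddr0 //.
- by rewrite peval_cat IH1 IH2.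
- by rewrite peval_opp IH.
- by rewrite peval_mul IH1 IH2.
Qed.

Lemma peval_extract b s p q :
  extract b s p = Some q -> peval p = seval (b, s) + peval q.
Proof.
elim: p q => [//|[c t] p IH] q /=.
case: ifP => [/andP[/eqP-> /mono_eqbP->] [->]//|_].
by case E: (extract b s p) => [r|//] [<-] /=; rewrite (IH _ E) aaddCA.
Qed.

Lemma peval_cancels n p : cancels n p -> peval p = 0.
Proof.
elim: n p => [[]//|n IH [|[b s] p]] //=.
case E: (extract _ _ _) => [q|//] /IH e.
by rewrite (peval_extract E) e aaddr0 seval_opp aaddrN.
Qed.

Section Variety.

Variable nf : mono -> poly_mono.
Hypothesis nfP : forall s, peval (nf s) = meval s.

Definition normalize (p : poly_mono) : poly_mono :=
  flatten [seq (if m.1 then popp (nf m.2) else nf m.2) | m <- p].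

Lemma peval_normalize p : peval (normalize p) = peval p.
Proof.
elim: p => [//|[b s] p IH]; rewrite /normalize /= peval_cat -/(normalize p) IH.
by congr (_ + _); case: b; rewrite /seval /= ?peval_opp nfP.
Qed.

Definition decide_eq (e1 e2 : expr) : bool :=
  let p := normalize (expand (Add e1 (Opp e2))) in cancels (size p) p.

Lemma decide_eqP e1 e2 : decide_eq e1 e2 -> eval e1 = eval e2.
Proof.
move=> /peval_cancels; rewrite peval_normalize peval_expand /=.
by move=> /asub_eq0.
Qed.

End Variety.

Definition nf_free (s : mono) : poly_mono := [:: (false, s)].

Lemma nf_freeP s : peval (nf_free s) = meval s.
Proof. by rewrite /= /seval aaddr0. Qed.

Lemma free_eqP e1 e2 : decide_eq nf_free e1 e2 -> eval e1 = eval e2.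
Proof. exact: (decide_eqP nf_freeP). Qed.

End Eval.

(** Together with [free_eqP] these make a linear-combination calculus: an
    equation follows from others once a combination of their differences,
    possibly multiplied by elements of the algebra, is its difference. *)
Lemma eq_from (x y l r : T) : l = r -> x - y = l - r -> x = y.
Proof. by move=> -> e; apply/asub_eq0; rewrite e; apply/asub_eq0. Qed.

Lemma eqD (x y z t : T) : x = y -> z = t -> x + z = y + t.
Proof. by move=> -> ->. Qed.

Lemma eqN (x y : T) : x = y -> - x = - y.
Proof. by move=> ->. Qed.

Lemma eqB (x y z t : T) : x = y -> z = t -> x - z = y - t.
Proof. by move=> -> ->. Qed.

Lemma eqMl (z x y : T) : x = y -> z * x = z * y.
Proof. by move=> ->. Qed.

End Calculus.

Ltac mem_atom x l :=
  lazymatch l with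
  | nil => constr:(false)
  | cons x _ => constr:(true)
  | cons _ ?l' => mem_atom x l'
  end.

Ltac add_atom x l :=
  let b := mem_atom x l in
  lazymatch b with true => l | false => constr:(cons x l) end.

Ltac index_atom x l :=
  lazymatch l with
  | cons x _ => constr:(O)
  | cons _ ?l' => let n := index_atom x l' in constr:(S n)
  end.

Ltac collect_atoms A l t :=
  lazymatch t with
  | @azero _ _ A => l
  | @aone _ _ A => l
  | @aadd _ _ A ?x ?y => let l1 := collect_atoms A l x in collect_atoms A l1 y
  | @asub _ _ A ?x ?y => let l1 := collect_atoms A l x in collect_atoms A l1 y
  | @amul _ _ A ?x ?y => let l1 := collect_atoms A l x in collect_atoms A l1 y
  | @aopp _ _ A ?x => collect_atoms A l x
  | ?x => add_atom x l
  end.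

Ltac reify_expr A l t :=
  lazymatch t with
  | @azero _ _ A => constr:(Zero)
  | @aone _ _ A => constr:(One)
  | @aadd _ _ A ?x ?y =>
      let p := reify_expr A l x in let q := reify_expr A l y in constr:(Add p q)
  | @asub _ _ A ?x ?y =>
      let p := reify_expr A l x in let q := reify_expr A l y in
      constr:(Add p (Opp q))
  | @amul _ _ A ?x ?y =>
      let p := reify_expr A l x in let q := reify_expr A l y in constr:(Mul p q)
  | @aopp _ _ A ?x => let p := reify_expr A l x in constr:(Opp p)
  | ?x => let n := index_atom x l in constr:(Var n)
  end.

(** [alg A] decides equations in [A], up to the laws of nonassociative rings.
    Associators and commutators are atoms: an identity between associators is
    used as it stands, and only the [expand] variants go down to products. *)
Tactic Notation "alg" constr(A) :=
  lazymatch goal with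
  | |- @eq ?T ?x ?y =>
      let l0 := collect_atoms A (@nil T) x in
      let l := collect_atoms A l0 y in
      let p := reify_expr A l x in
      let q := reify_expr A l y in
      let env := constr:(nth (azero A) l) in
      change (eval A env p = eval A env q);
      refine (@free_eqP _ _ A env p q _); vm_compute; reflexivity
  end.

Tactic Notation "alg_from" constr(A) uconstr(e) :=
  refine (@eq_from _ _ A _ _ _ _ e _); alg A.

Tactic Notation "alg_expand" constr(A) := rewrite /associator /commutator; alg A.

Tactic Notation "alg_expand_from" constr(A) uconstr(e) :=
  refine (@eq_from _ _ A _ _ _ _ e _); alg_expand A.

(** * Alternative algebras *)

Section Alternative.

Variables (F : fieldType) (T : Type) (A : algebra F T).
Hypothesis altA : alternative A.

Local Notation "0" := (azero A).
Local Notation "1" := (aone A).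
Local Notation "- x" := (aopp A x).
Local Notation "x + y" := (aadd A x y).
Local Notation "x - y" := (asub A x y).
Local Notation "x * y" := (amul A x y).
Local Notation "a *: x" := (ascale A a x).
Local Notation assoc := (associator A).

Lemma assocC12 x y z : assoc x y z = - assoc y x z.
Proof.
have [h _] := altA (x + y) z; have [hx _] := altA x z; have [hy _] := altA y z.
alg_expand_from A (eqB A (eqB A h hx) hy).
Qed.

Lemma assocC23 x y z : assoc x y z = - assoc x z y.
Proof.
have [_ h] := altA (y + z) x; have [_ hy] := altA y x; have [_ hz] := altA z x.
alg_expand_from A (eqB A (eqB A h hy) hz).
Qed.

Lemma assoc_rot x y z : assoc x y z = assoc y z x.
Proof. by rewrite assocC12 assocC23 aoppK. Qed.

Lemma assoc_xyx x y : assoc x y x = 0.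
Proof. by rewrite assoc_rot; case: (altA x y). Qed.

(** The Teichmueller identity. *)
Lemma assoc_mul w x y z :
  assoc (w * x) y z - assoc w (x * y) z + assoc w x (y * z) =
  w * assoc x y z + assoc w x y * z.
Proof. alg_expand A. Qed.

Let kleinfeld w x y z := assoc (w * x) y z - x * assoc w y z - assoc x y z * w.

Lemma kleinfeld_rot w x y z : kleinfeld w x y z = - kleinfeld z w x y.
Proof.
have e1 := assoc_mul w x y z; have e2 := assoc_mul x y z w.
rewrite (assoc_rot w (x * y)) -(assoc_rot (y * z) w) in e1.
rewrite (assoc_rot x (y * z)) -(assoc_rot (z * w) x) in e2.
rewrite /kleinfeld (assoc_rot w y z) (assoc_rot z x y).
alg_from A (eqD A e1 e2).
Qed.

Lemma kleinfeldC34 w x y z : kleinfeld w x y z = - kleinfeld w x z y.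
Proof.
rewrite /kleinfeld (assocC23 (w * x)) (assocC23 w) (assocC23 x); alg A.
Qed.

Lemma kleinfeld_xx w x y : kleinfeld w y x x = 0.
Proof.
rewrite /kleinfeld !(proj2 (altA _ _)); alg A.
Qed.

Lemma kleinfeldC13_24 w x y z : kleinfeld w x y z = kleinfeld y z w x.
Proof. by rewrite kleinfeld_rot kleinfeld_rot aoppK. Qed.

Lemma kleinfeldC12 w x y z : kleinfeld w x y z = - kleinfeld x w y z.
Proof. by rewrite kleinfeldC13_24 kleinfeldC34 -kleinfeldC13_24. Qed.

(** Kleinfeld's function is alternating, which yields the two laws that let an
    element be pulled out of an associator in which it occurs twice. *)
Lemma assoc_pullr x y z : assoc x (x * y) z = assoc x y z * x.
Proof.
have: kleinfeld x y x z = 0.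
  by rewrite kleinfeld_rot kleinfeldC34 kleinfeld_rot kleinfeld_xx !aoppK aopp0.
rewrite /kleinfeld (proj1 (altA x z)) assocC12 (assocC12 y x z) => e.
alg_from A (eqN A e).
Qed.

Lemma assoc_pulll x y z : assoc x (y * x) z = x * assoc x y z.
Proof.
have: kleinfeld y x x z = 0.
  by rewrite kleinfeld_rot kleinfeld_rot kleinfeldC34 kleinfeldC12
    kleinfeld_rot kleinfeld_xx !aopp0.
rewrite /kleinfeld (proj1 (altA x z)) assocC12 (assocC12 y x z) => e.
alg_from A (eqN A e).
Qed.

Lemma assoc_sqr x y z : assoc (x * x) y z = x * assoc x y z + assoc x y z * x.
Proof.
have: kleinfeld x x y z = 0.
  by rewrite kleinfeld_rot kleinfeld_rot kleinfeld_xx !aopp0.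
by rewrite /kleinfeld => e; alg_from A e.
Qed.

(** Invariance of Kleinfeld's function under an even permutation. *)
Lemma assoc_mulC x u y v :
  assoc (x * u) y v - u * assoc x y v - assoc u y v * x =
  assoc (y * v) x u - v * assoc y x u - assoc v x u * y.
Proof. exact: kleinfeldC13_24. Qed.

End Alternative.

(** * The quaternion algebra of 2 x 2 matrices *)

Section Matrices.

Variable F : fieldType.
Local Open Scope ring_scope.

Definition mxconj (h : 'M[F]_2) : 'M[F]_2 := (\tr h)%:M - h.

Definition bit (i : bool) : 'I_2 := if i then 1 else 0.

Definition E (i j : bool) : 'M[F]_2 := delta_mx (bit i) (bit j).

Lemma mulmx_E i j k l : E i j *m E k l = if j == k then E i l else 0.
Proof. by rewrite mul_delta_mx_cond; case: j; case: k. Qed.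

Lemma E_sum : E false false + E true true = 1%:M.
Proof.
by apply/matrixP=> i j; rewrite !mxE; case: i j => [[|[|?]] ?] [[|[|?]] ?];
  rewrite //= ?addr0 ?add0r.
Qed.

Lemma mxconjD h k : mxconj (h + k) = mxconj h + mxconj k.
Proof. by rewrite /mxconj mxtraceD raddfD /= addrACA opprD. Qed.

Lemma mxconjZ a h : mxconj (a *: h) = a *: mxconj h.
Proof. by rewrite /mxconj mxtraceZ scalerBr scale_scalar_mx. Qed.

Lemma mxconj_E i j : mxconj (E i j) = if i == j then E (~~ i) (~~ i) else - E i j.
Proof.
rewrite /mxconj /E; have -> : \tr (delta_mx (bit i) (bit j)) = (i == j)%:R :> F.
  by rewrite /mxtrace !big_ord_recl big_ord0 !mxE; case: i; case: j;
    rewrite /= ?addr0 ?add0r.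
case: i; case: j; rewrite /= ?raddf0 ?sub0r //; rewrite -E_sum /E /=;
  by [rewrite addrK|rewrite addrC addKr].
Qed.

Lemma mxconj1 : mxconj 1%:M = 1%:M.
Proof. by rewrite -{1}E_sum mxconjD !mxconj_E /= addrC E_sum. Qed.

Lemma mx2_eq (h k : 'M[F]_2) :
  (forall i j, h (bit i) (bit j) = k (bit i) (bit j)) -> h = k.
Proof.
move=> e; apply/matrixP=> i j.
have bitK (l : 'I_2) : exists b, l = bit b.
  by case: l => [[|[|?]] p] //; [exists false|exists true]; apply: val_inj.
by have [b ->] := bitK i; have [c ->] := bitK j.
Qed.

Lemma sum_bit (f : 'I_2 -> F) : \sum_i f i = f (bit false) + f (bit true).
Proof.
rewrite !big_ord_recl big_ord0 addr0; congr (f _ + f _); exact: val_inj.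
Qed.

Lemma mxconjM h k : mxconj (h *m k) = mxconj k *m mxconj h.
Proof.
apply: mx2_eq => i j.
rewrite /mxconj /mxtrace !(mxE, sum_bit).
by case: i; case: j => /=; ring.
Qed.

Lemma mxconj_comm h k : 
  mxconj h *m mxconj k - mxconj k *m mxconj h = h *m k - k *m h.
Proof.
by rewrite /mxconj !mulmxBl !mulmxBr !mul_scalar_mx !mul_mx_scalar
  !scale_scalar_mx mulrC !opprB !addrA; apply/matrixP=> i j; rewrite !mxE; ring.
Qed.

Lemma mxconj_trace h k : mxconj h *m k + h *m k = k *m mxconj h + k *m h.
Proof. by rewrite -mulmxDl -mulmxDr subrK scalar_mxC. Qed.

Lemma mx2_span (h : 'M[F]_2) :
  h = h 0 0 *: E false false + h 0 1 *: E false true +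
      h 1 0 *: E true false + h 1 1 *: E true true.
Proof.
by apply: mx2_eq => i j; rewrite !mxE; case: i; case: j => /=; ring.
Qed.

Lemma mx2_ind (P : 'M[F]_2 -> Prop) :
  (forall h k, P h -> P k -> P (h + k)) -> (forall a h, P h -> P (a *: h)) ->
  (forall i j, P (E i j)) -> forall h, P h.
Proof. by move=> PD PZ PE h; rewrite (mx2_span h); do 3?apply: (PD); apply: PZ. Qed.

End Matrices.

(** * Structure of an alternative algebra over its subalgebra of matrices *)

Section Structure.

Variables (F : fieldType) (T : Type) (B : M2_algebra F T).

Local Notation A := (M2_alg B).
Local Notation "0" := (azero A).
Local Notation "1" := (aone A).
Local Notation "- x" := (aopp A x).
Local Notation "x + y" := (aadd A x y).
Local Notation "x - y" := (asub A x y).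
Local Notation "x * y" := (amul A x y).
Local Notation "a *: x" := (ascale A a x).
Local Notation assoc := (associator A).
Local Notation phi := (M2_phi B).
Local Notation e i j := (phi (E F i j)).
Local Notation e00 := (e false false).
Local Notation e01 := (e false true).
Local Notation e10 := (e true false).
Local Notation e11 := (e true true).

Let altA : alternative A := M2_alternative B.
Let assoc_rot := assoc_rot altA.
Let assocC12 := assocC12 altA.
Let assocC23 := assocC23 altA.
Let assoc_pullr := assoc_pullr altA.
Let assoc_pulll := assoc_pulll altA.

Lemma phiD h k : phi (h + k)%R = phi h + phi k.
Proof. exact: (homD (M2_phi_hom B)). Qed.

Lemma phiZ a h : phi (a *: h)%R = a *: phi h.
Proof. exact: (homZ (M2_phi_hom B)). Qed.

Lemma phiM h k : phi (h *m k)%R = phi h * phi k.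
Proof. exact: (homM (M2_phi_hom B)). Qed.

Lemma phi1 : phi 1%:M%R = 1.
Proof. exact: (hom1 (M2_phi_hom B)). Qed.

Lemma phi0 : phi 0%R = 0.
Proof. by rewrite -(scale0r 0%R) phiZ ascale0r. Qed.

Lemma phiN h : phi (- h)%R = - phi h.
Proof. by rewrite -scaleN1r phiZ ascaleN1. Qed.

Lemma phiB h k : phi (h - k)%R = phi h - phi k.
Proof. by rewrite phiD phiN. Qed.

Lemma e_mul i j k l : e i j * e k l = if j == k then e i l else 0.
Proof. by rewrite -phiM mulmx_E; case: (j == k); rewrite ?phi0. Qed.

Lemma e_sum : e00 + e11 = 1.
Proof. by rewrite -phiD E_sum phi1. Qed.

Lemma phi_scalar a : phi a%:M%R = a *: 1.
Proof. by rewrite -scalemx1 phiZ phi1. Qed.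

Lemma phi_mxconj h : phi (mxconj h) = (\tr h)%R *: 1 - phi h.
Proof. by rewrite phiB phi_scalar. Qed.

Lemma assoc_mxconjr x y h : assoc x y (phi (mxconj h)) = - assoc x y (phi h).
Proof.
rewrite phi_mxconj /associator /asub !(amulDr, amulNr, amulZr) !amul1r; alg A.
Qed.

Lemma assoc_mxconjm x y h : assoc x (phi (mxconj h)) y = - assoc x (phi h) y.
Proof.
by rewrite !(assocC23 x _ y) assoc_mxconjr.
Qed.

(** In matrices over the even part plus columns over the odd part of a
    Gamma-algebra these three are, in this order, the even scalar matrices, the
    columns and the matrices. *)
Definition centralizer (c : T) : Prop := forall h, c * phi h = phi h * c.

Definition conj_part (w : T) : Prop := forall h, phi h * w = w * phi (mxconj h).

Definition assoc_part (n : T) : Prop := forall h k, assoc n (phi h) (phi k) = 0.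

Lemma centralizer_subspace : is_subspace A centralizer.
Proof.
split=> [h|x y cx cy h|a x cx h]; first by rewrite amul0r amulr0.
  by rewrite amulDl amulDr cx cy.
by rewrite amulZl amulZr cx.
Qed.

Lemma conj_part_subspace : is_subspace A conj_part.
Proof.
split=> [h|x y cx cy h|a x cx h]; first by rewrite amul0r amulr0.
  by rewrite amulDl amulDr cx cy.
by rewrite amulZl amulZr cx.
Qed.

Lemma assoc_part_subspace : is_subspace A assoc_part.
Proof.
split=> [h k|x y cx cy h k|a x cx h k].
- alg_expand A.
- alg_expand_from A (eqD A (cx h k) (cy h k)).
- have := cx h k; rewrite /associator !amulZl => /asub_eq0 ->; exact: aaddrN.
Qed.

Lemma centralizer_e c : (forall i j, c * e i j = e i j * c) -> centralizer c.
Proof.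
move=> ce; apply: mx2_ind => // [h k eh ek|a h eh].
  by rewrite phiD amulDl amulDr eh ek.
by rewrite phiZ amulZl amulZr eh.
Qed.

Lemma conj_part_e w :
  (forall i j, e i j * w = w * phi (mxconj (E F i j))) -> conj_part w.
Proof.
move=> we; apply: (@mx2_ind _ (fun h => phi h * w = w * phi (mxconj h))) => //.
- move=> h k eh ek; by rewrite mxconjD phiD (phiD (mxconj h)) amulDl amulDr eh ek.
- by move=> a h eh; rewrite mxconjZ !phiZ amulZl amulZr eh.
Qed.

(** ** The part on which the matrices act through conjugation *)

(** The product [phi k * (w * phi (mxconj h))] is expanded once by rotating an
    associator and once by flexibility.  The associators cancel in the
    difference because conjugating a matrix only changes their sign. *)
Lemma conj_part_mulA w h k : conj_part w -> w * phi k * phi h = w * phi (h *m k)%R.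
Proof.
move=> Jw; apply/esym.
have e1 : assoc (phi k) (phi h) w = assoc w (phi k) (phi h) by rewrite -assoc_rot.
rewrite {1}/associator -phiM !Jw mxconjM phiM in e1.
have e2 : assoc (phi k) w (phi (mxconj h)) = - assoc w (phi k) (phi (mxconj h)).
  exact: assocC12.
rewrite (assoc_mxconjr w) aoppK {1}/associator Jw in e2.
have e3 : assoc w (phi (mxconj k)) (phi (mxconj h)) = assoc w (phi k) (phi h).
  by rewrite assoc_mxconjr assoc_mxconjm aoppK.
have e4 := congr1 phi (mxconj_comm h k); rewrite !phiB !phiM in e4.
rewrite phiM.
have e5 : w * (phi (mxconj h) * phi (mxconj k)) -
    w * (phi (mxconj k) * phi (mxconj h)) = assoc w (phi k) (phi h).
  move: e1 e2 e3; rewrite /associator => e1 e2 e3.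
  alg_from A (eqD A (eqB A e1 e2) e3).
alg_expand_from A (eqB A e5 (eqMl A w e4)).
Qed.

Lemma conj_part_lmul w h k : conj_part w ->
  phi h * (w * phi k) = w * phi (mxconj h *m k)%R.
Proof.
move=> Jw.
have e1 : assoc (phi h) w (phi k) = - assoc w (phi h) (phi k) by apply: assocC12.
rewrite /associator Jw !conj_part_mulA // -phiM in e1.
have e2 := eqMl A w (congr1 phi (mxconj_trace h k)); rewrite !phiD in e2.
alg_from A (eqB A (eqN A e1) e2).
Qed.

Lemma conj_part_mul w h : conj_part w -> conj_part (w * phi h).
Proof.
by move=> Jw k; rewrite conj_part_lmul // conj_part_mulA.
Qed.

Lemma assoc_conj_part w h k : conj_part w ->
  assoc w (phi h) (phi k) = w * phi (k *m h - h *m k)%R.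
Proof.
by move=> Jw; rewrite /associator conj_part_mulA // -phiM phiB amulDr amulNr.
Qed.

(** Used with [e00], [e01], [e10] as [e], [p], [q], and with the two indices
    exchanged. *)
Lemma assoc_diag_mul (p q e u : T) : p * e = 0 -> e * p = p -> p * q = e ->
  let g := assoc p q u in (e * g + g * e - g) * p = 0.
Proof.
move=> pe ep pq g.
have pull v : assoc p e v = assoc p q v * p by rewrite -assoc_pullr pq.
have z : e * (g * p) = 0.
  have := assoc_pulll e p u; rewrite pe => h.
  have h0 : assoc 0 e u = 0 by alg_expand A.
  have h1 : assoc 0 e u = - assoc e 0 u by apply: assocC12.
  rewrite h0 in h1; rewrite (assocC12 e p) pull in h.
  rewrite -/g in h; alg_from A (eqB A h h1).
have r1 : (e * g) * p = assoc p q g * p.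
  have h := assoc_rot p e g; rewrite pull {2}/associator in h.
  alg_from A (eqB A z h).
have r2 : (g * e) * p = g * p - assoc p q g * p.
  have h : assoc g e p = - (assoc p q g * p) by rewrite assoc_rot assocC12 pull.
  rewrite {1}/associator ep in h; alg_from A h.
alg_from A (eqD A r1 r2).
Qed.

(** For [e01] and [e10] the two laws that pull an element out of an associator
    compute the associators of [u] with a diagonal matrix unit, and those for
    [e00] and [e11] are opposite as [e00 + e11 = 1].  For [e00] the defect
    [t = e00 * g + g * e00 - g] satisfies [t * e01 = t * e10 = 0], and then
    skew-symmetry of the associator of [t], [e01], [e10] gives
    [t * (e00 + e11) = 0]. *)
Lemma conj_part_assoc u : conj_part (assoc e01 e10 u).
Proof.
set g := assoc _ _ _.
have g01 : e01 * g = - (g * e01).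
  have h1 := assoc_pullr e01 e10 u; have h2 := assoc_pulll e01 e10 u.
  rewrite e_mul /= in h1; rewrite e_mul /= in h2.
  have h3 : assoc e01 1 u = 0 by alg_expand A.
  rewrite -e_sum in h3.
  rewrite -/g in h1 h2; rewrite /associator in h1 h2 h3.
  alg_from A (eqB A h3 (eqD A h1 h2)).
have g10 : e10 * g = - (g * e10).
  have h1 := assoc_pullr e10 e01 u; have h2 := assoc_pulll e10 e01 u.
  rewrite e_mul /= assocC12 (assocC12 e10 e01) -/g in h1.
  rewrite e_mul /= assocC12 (assocC12 e10 e01) -/g in h2.
  have h3 : assoc 1 e10 u = 0 by alg_expand A.
  rewrite -e_sum in h3.
  rewrite /associator in h1 h2 h3.
  alg_from A (eqD A h3 (eqD A h1 h2)).
have d0 : e00 * g + g * e00 = g.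
  have t1 := @assoc_diag_mul e01 e10 e00 u; rewrite !e_mul /= -/g in t1.
  have t2 := @assoc_diag_mul e10 e01 e11 u; rewrite !e_mul /= -/g in t2.
  rewrite assocC12 -/g in t2.
  set t := e00 * g + g * e00 - g.
  have {}t1 : t * e01 = 0 by apply: t1.
  have {}t2 : t * e10 = 0.
    have e11E : e11 = 1 - e00 by rewrite -e_sum; alg A.
    have := t2 erefl erefl erefl; rewrite /t e11E => h.
    alg_from A h.
  have h : assoc t e01 e10 = - assoc t e10 e01 by apply: assocC23.
  rewrite /associator t1 t2 !e_mul /= in h.
  have {}h : t * (e00 + e11) = 0 by alg_from A (eqN A h).
  by move: h; rewrite e_sum amul1r => /asub_eq0.
have e11E : e11 = 1 - e00 by rewrite -e_sum; alg A.
apply: conj_part_e => -[] [] /=; rewrite mxconj_E /=; last first.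
- rewrite e11E; alg_from A d0.
- by rewrite phiN amulNr.
- by rewrite phiN amulNr.
- rewrite e11E; alg_from A (eqN A d0).
Qed.

Local Notation d := (E F true true - E F false false)%R.

Lemma sqr_d : (d *m d)%R = 1%:M%R.
Proof.
by rewrite mulmxBl !mulmxBr !mulmx_E /= sub0r subr0 opprK addrC E_sum.
Qed.

Lemma conj_part_d w : conj_part w -> w * phi d * phi d = w.
Proof. by move=> Jw; rewrite conj_part_mulA // sqr_d phi1 amul1r. Qed.

Lemma conj_part_assoc_eq0 w : conj_part w -> assoc_part w -> w = 0.
Proof.
move=> Jw Nw; have := Nw (E F false true) (E F true false).
rewrite assoc_conj_part // !mulmx_E /= => wd.
by rewrite -(conj_part_d Jw) wd amul0r.
Qed.

(** The laws that pull an element out of an associator reduce all pairs of matrix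
    units to this one. *)
Lemma assoc_partP n : assoc n e01 e10 = 0 -> assoc_part n.
Proof.
move=> n0.
have z0 : assoc e01 e10 n = 0 by rewrite -assoc_rot.
have z1 : assoc e10 e01 n = 0 by rewrite assocC12 z0 aopp0.
have z2 : assoc n e01 e00 = 0.
  by rewrite assoc_rot; have := assoc_pullr e01 e10 n; rewrite e_mul z0 amul0r.
have z3 : assoc n e01 e11 = 0.
  by rewrite assoc_rot; have := assoc_pulll e01 e10 n; rewrite e_mul z0 amulr0.
have z4 : assoc n e10 e11 = 0.
  by rewrite assoc_rot; have := assoc_pullr e10 e01 n; rewrite e_mul z1 amul0r.
have z5 : assoc n e10 e00 = 0.
  by rewrite assoc_rot; have := assoc_pulll e10 e01 n; rewrite e_mul z1 amulr0.
have z6 : assoc n e00 e11 = 0.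
  have e11E : e11 = 1 - e00 by rewrite -e_sum; alg A.
  have [_ h] := altA e00 n; rewrite e11E; alg_expand_from A (eqN A h).
have sw u v : assoc n u v = 0 -> assoc n v u = 0.
  by move=> h; rewrite assocC23 h aopp0.
have zE i j k l : assoc n (e i j) (e k l) = 0.
  by case: i; case: j; case: k; case: l; 
     (exact: (proj2 (altA _ _)) || assumption || (apply: sw; assumption)).
move=> h; apply: (@mx2_ind _ (fun k => _ = _)) => [k k' ek ek'|a k ek|k l].
- rewrite phiD; alg_expand_from A (eqD A ek ek').
- by rewrite phiZ /associator !amulZr; move/asub_eq0: ek => ->; apply: aaddrN.
move: h; apply: (@mx2_ind _ (fun h => _ = _)) => [h h' eh eh'|a h eh|//].
- rewrite phiD; alg_expand_from A (eqD A eh eh').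
- rewrite phiZ /associator !(amulZr, amulZl).
  by move/asub_eq0: eh => ->; apply: aaddrN.
Qed.

(** On the conjugation part the associator with [e01] and [e10] is right
    multiplication by [d = e11 - e00], and [d * d = 1]; this dictates the
    component of [u]. *)
Lemma assoc_conj_decomp u :
  exists n w, assoc_part n /\ conj_part w /\ u = n + w.
Proof.
pose w := assoc e01 e10 u * phi d.
have Jw : conj_part w by apply/conj_part_mul/conj_part_assoc.
exists (u - w), w; split; last by split=> //; alg A.
apply: assoc_partP.
have : assoc w e01 e10 = assoc u e01 e10.
  rewrite assoc_conj_part // !mulmx_E /= conj_part_d; first by rewrite -assoc_rot.
  exact: conj_part_assoc.
by move=> h; alg_expand_from A (eqN A h).
Qed.

(** [D = (e, c, u)] satisfies [e * D = D * e] and [D = e * D + D * e], so that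
    [D = 2 (e * D)].  Multiplying by [e] gives [e * D = 2 (e * D)], hence
    [e * D = 0] in every characteristic. *)
Lemma idempotent_assoc e c u : e * e = e -> c * e = e * c -> assoc c e u = 0.
Proof.
move=> ee ce; rewrite assocC12; set D := assoc e c u.
have h1 : e * D = D * e by rewrite -assoc_pullr -assoc_pulll ce.
have h2 : D = e * D + D * e by rewrite -(assoc_sqr altA) ee.
rewrite -h1 in h2.
have h3 : e * (e * D) = e * D.
  by have [h _] := altA e D; rewrite -{3}ee; alg_expand_from A (eqN A h).
have h4 : e * D = 0.
  have h5 := eqMl A e h2; rewrite amulDr h3 in h5; alg_from A (eqN A h5).
by rewrite h2 h4 aadd0 aopp0.
Qed.

Section Centralizer.

Variable c : T.
Hypothesis Cc : centralizer c.

Lemma cent_assoc h u : assoc c (phi h) u = 0.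
Proof.
have idm k : (k *m k)%R = k -> assoc c (phi k) u = 0.
  by move=> kk; apply: idempotent_assoc; rewrite -?phiM ?kk.
have sum k l : assoc c (phi k) u = 0 -> assoc c (phi (k + l)%R) u = 0 ->
    assoc c (phi l) u = 0.
  by rewrite phiD => h1 h2; alg_expand_from A (eqB A h2 h1).
have z : assoc c e00 u = 0 by apply: idm; rewrite mulmx_E.
move: h; apply: (@mx2_ind _ (fun h => _ = _)) => [h h' eh eh'|a h eh|i j].
- rewrite phiD; alg_expand_from A (eqD A eh eh').
- rewrite phiZ /associator !(amulZr, amulZl).
  by move/asub_eq0: eh => ->; apply: aaddrN.
case: i; case: j => //.
- by apply: idm; rewrite mulmx_E.
- apply: (sum _ _ z); apply: idm.
  by rewrite mulmxDl !mulmxDr !mulmx_E /= !addr0.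
- apply: (sum _ _ z); apply: idm.
  by rewrite mulmxDl !mulmxDr !mulmx_E /= !addr0.
Qed.

Lemma cent_assoc' h u : assoc (phi h) c u = 0.
Proof. by rewrite assocC12 cent_assoc aopp0. Qed.

Lemma centlA h u : c * phi h * u = c * (phi h * u).
Proof. exact/asub_eq0/cent_assoc. Qed.

Lemma cent_lA h u : phi h * c * u = phi h * (c * u).
Proof. exact/asub_eq0/cent_assoc'. Qed.

Lemma centrA h u : c * u * phi h = c * (u * phi h).
Proof.
by apply/(asub_eq0 A); change (assoc c u (phi h) = 0); rewrite -assoc_rot cent_assoc'.
Qed.

Lemma cent_lrA h u : phi h * u * c = phi h * (u * c).
Proof.
by apply/(asub_eq0 A); change (assoc (phi h) u c = 0); rewrite -assoc_rot cent_assoc.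
Qed.

(** Kleinfeld's function vanishes on [c], [phi h] and two further elements, as
    one of its values consists of associators of [c] with [phi h]. *)
Lemma cent_assoc_mull h u v :
  assoc (c * phi h) u v = phi h * assoc c u v + assoc (phi h) u v * c.
Proof.
have := assoc_mulC altA c (phi h) u v.
by rewrite !(assoc_rot _ c) !cent_assoc => z; alg_from A z.
Qed.

Lemma cent_assoc_mulr h u v :
  assoc (phi h * c) u v = c * assoc (phi h) u v + assoc c u v * phi h.
Proof.
have := assoc_mulC altA (phi h) c u v.
by rewrite !(assoc_rot _ (phi h)) !cent_assoc' => z; alg_from A z.
Qed.

Lemma cent_comm_conj w : conj_part w -> c * w = w * c.
Proof.
move=> Jw.
have wE : assoc e01 e10 (w * phi d) = w.
  rewrite -assoc_rot assoc_conj_part ?mulmx_E; last exact: conj_part_mul.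
  by rewrite conj_part_d.
have := cent_assoc_mull (E F false true) e10 (w * phi d).
rewrite Cc cent_assoc_mulr cent_assoc wE amul0r amulr0 => e.
alg_from A e.
Qed.

Lemma cent_mul_conj w : conj_part w -> conj_part (c * w).
Proof.
by move=> Jw h; rewrite -cent_lA -Cc centlA Jw centrA.
Qed.

Lemma cent_mul_assoc n : assoc_part n -> assoc_part (c * n).
Proof.
move=> Nn h k; have /asub_eq0 := Nn h k; rewrite -phiM => e.
by rewrite /associator -phiM !centrA e; apply: aaddrN.
Qed.

Lemma cent_conj_eq0 : conj_part c -> c = 0.
Proof.
move=> Jc; have := Jc (E F false false); rewrite -Cc mxconj_E /= => e.
have z : c * phi d = 0 by rewrite phiB amulDr amulNr e aaddrN.
by rewrite -(conj_part_d Jc) z amul0r.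
Qed.

End Centralizer.

Lemma centralizerM c c' : centralizer c -> centralizer c' -> centralizer (c * c').
Proof. by move=> Cc Cc' h; rewrite centrA // Cc' -centlA // Cc cent_lA. Qed.

Lemma cent_cent_assoc_mul c c' u h : centralizer c -> centralizer c' ->
  assoc c (c' * phi h) u = phi h * assoc c c' u.
Proof.
move=> Cc Cc'.
rewrite assocC12 cent_assoc_mull // cent_assoc' // amul0r aaddr0.
by rewrite (assocC12 c') amulNr aoppK.
Qed.

Lemma cent_cent_assoc_cent c c' u : centralizer c -> centralizer c' ->
  centralizer (assoc c c' u).
Proof.
move=> Cc Cc' h; rewrite -cent_cent_assoc_mul // (assocC12 c (c' * _)).
rewrite Cc' cent_assoc_mulr // cent_assoc' // amulr0 aadd0.
by rewrite (assocC12 c') amulNl aoppK.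
Qed.

Lemma assoc_part_lmul h n : assoc_part n -> assoc_part (phi h * n).
Proof.
move=> Nn.
have r k l k' : assoc (n * phi k) (phi l) (phi k') = 0.
  have := assoc_mul A n (phi k) (phi l) (phi k').
  rewrite -!phiM !Nn amul0r.
  have -> : assoc (phi k) (phi l) (phi k') = 0.
    by rewrite /associator -!phiM mulmxA; apply: aaddrN.
  by rewrite amulr0 => z; alg_from A z.
move=> k l; have := assoc_mul A (phi h) n (phi k) (phi l).
rewrite -phiM Nn amulr0 !(assoc_rot (phi h) n) !Nn amul0r.
by rewrite (assoc_rot _ (n * _)) r => z; alg_from A z.
Qed.

(** For an element of the associative part this is its coefficient at [e i j]. *)
Definition mx_coord n (i j : bool) : T :=
  e false i * n * e j false + e true i * n * e j true.

Section Coord.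

Variable n : T.
Hypothesis Nn : assoc_part n.

Let sandwich h k := phi h * n * phi k.

Lemma sandwich_r h k l : sandwich h k * phi l = sandwich h (k *m l)%R.
Proof.
by rewrite /sandwich phiM; apply/(asub_eq0 A)/(assoc_part_lmul h Nn).
Qed.

Lemma sandwich_l h k l : phi l * sandwich h k = sandwich (l *m h)%R k.
Proof.
have hn : phi l * (phi h * n) = phi (l *m h)%R * n.
  by apply/esym/(asub_eq0 A); rewrite phiM; change (assoc (phi l) (phi h) n = 0);
    rewrite -assoc_rot.
rewrite /sandwich -hn; apply/esym/(asub_eq0 A).
change (assoc (phi l) (phi h * n) (phi k) = 0); rewrite assoc_rot.
exact: assoc_part_lmul.
Qed.

Lemma sandwich0l k : sandwich 0%R k = 0.
Proof. by rewrite /sandwich phi0 !amul0r. Qed.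

Lemma sandwich0r k : sandwich k 0%R = 0.
Proof. by rewrite /sandwich phi0 !amulr0. Qed.

Lemma mx_coord_centralizer i j : centralizer (mx_coord n i j).
Proof.
apply: centralizer_e => k l; rewrite /mx_coord.
rewrite -!/(sandwich _ _) amulDl amulDr !sandwich_r !sandwich_l !mulmx_E.
by case: k; case: l; rewrite /= ?sandwich0l ?sandwich0r ?aadd0 ?aaddr0.
Qed.

Lemma mx_coord_sum :
  n = mx_coord n false false * e00 + mx_coord n false true * e01 +
      mx_coord n true false * e10 + mx_coord n true true * e11.
Proof.
rewrite /mx_coord -!/(sandwich _ _) !amulDl !sandwich_r !mulmx_E /=.
rewrite !sandwich0r !aadd0 !aaddr0 /sandwich.
by transitivity ((e00 + e11) * n * (e00 + e11)); [rewrite e_sum amul1l amul1r|alg A].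
Qed.

End Coord.

(** The associator [g] of [c], [c'] and [u] always commutes with the matrices.
    For [u] in the conjugation part it lies in that part as well, hence vanishes.
    For [u] in the centralizer, [phi h * g] is the associator of [c], [c'] and
    [u * phi h], so it too commutes with the matrices; therefore [g] is
    killed by all commutators of matrices, one of which is invertible. *)
Lemma cent_cent_assoc c c' u : centralizer c -> centralizer c' ->
  assoc c c' u = 0.
Proof.
move=> Cc Cc'.
have onC b : centralizer b -> assoc c c' b = 0.
  move=> Cb; set g := assoc c c' b.
  have Cg : centralizer g by apply: cent_cent_assoc_cent.
  have Chg h : centralizer (phi h * g).
    rewrite /g assoc_rot -cent_cent_assoc_mul // -assoc_rot.
    exact: cent_cent_assoc_cent.
  have z h k : phi (h *m k - k *m h)%R * g = 0.
    have := Chg h (k); rewrite cent_lA // Cg -!(cent_lrA Cg) => e.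
    by rewrite phiB !phiM amulDl amulNl e aaddrN.
  have dd := z (E F true false) (E F false true); rewrite !mulmx_E /= in dd.
  by rewrite -[g](amul1l A) -phi1 -sqr_d phiM (cent_lrA Cg) dd amulr0.
have additive u1 u2 : assoc c c' u1 = 0 -> assoc c c' u2 = 0 ->
    assoc c c' (u1 + u2) = 0.
  by move=> h1 h2; alg_expand_from A (eqD A h1 h2).
have onCH b h : centralizer b -> assoc c c' (b * phi h) = 0.
  move=> Cb; rewrite assoc_rot cent_cent_assoc_mul // -assoc_rot onC //.
  exact: amulr0.
have [n [w [Nn [Jw ->]]]] := assoc_conj_decomp u.
apply: (additive).
  rewrite (mx_coord_sum Nn); do 3?apply: (additive); apply: onCH;
    exact: mx_coord_centralizer.
apply: cent_conj_eq0; first exact: cent_cent_assoc_cent.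
have sJ := conj_part_subspace.
apply: (subspaceD sJ); last apply: (subspaceN sJ).
  by apply: cent_mul_conj => //; apply: centralizerM.
by do 2!apply: cent_mul_conj => //.
Qed.

(** ** Products of two elements of the conjugation part *)

Section ConjProducts.

Variables w w' : T.
Hypotheses (Jw : conj_part w) (Jw' : conj_part w').

Let mulr_conj h :
  w * (w' * phi (mxconj h)) = (\tr h)%R *: (w * w') - w * (w' * phi h).
Proof. by rewrite phi_mxconj !(amulDr, amulNr) !(amulZr, amul1r). Qed.

Let mull_conj h : w * phi (mxconj h) * w' = (\tr h)%R *: (w * w') - w * phi h * w'.
Proof.
by rewrite phi_mxconj !(amulDr, amulNr, amulDl, amulNl) amulZr amul1r amulZl.
Qed.

(** Rotating and transposing the associator of [w], [w'] and [phi h] gives two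
    linear equations for the products [w * (w' * phi h)] and
    [(w * phi h) * w']. *)
Lemma conj_conj_mulr h : w * (w' * phi h) = phi h * (w * w').
Proof.
have e1 : assoc w w' (phi h) = assoc (phi h) w w' by rewrite -assoc_rot.
have e2 : assoc w (phi h) w' = - assoc w w' (phi h) by apply: assocC23.
rewrite /associator Jw mull_conj in e1.
rewrite /associator Jw' mulr_conj in e2.
alg_from A (eqB A e2 e1).
Qed.

Lemma conj_conj_mull h : w * phi h * w' = w * w' * phi (mxconj h).
Proof.
have e1 : assoc w w' (phi h) = assoc (phi h) w w' by rewrite -assoc_rot.
rewrite /associator Jw mull_conj conj_conj_mulr in e1.
rewrite phi_mxconj amulDr amulNr amulZr amul1r.
alg_from A e1.
Qed.

End ConjProducts.

Lemma conj_conj_assoc_part w w' : conj_part w -> conj_part w' ->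
  assoc_part (w * w').
Proof.
move=> Jw Jw' h k; rewrite assoc_rot; apply/(asub_eq0 A).
rewrite -(conj_conj_mulr Jw Jw' k) -conj_conj_mulr //; last exact: conj_part_mul.
by rewrite conj_part_mulA // conj_conj_mulr // phiM.
Qed.

Section Nucleus.

Variable c : T.
Hypothesis Cc : centralizer c.

Lemma cent_assoc_part_assoc n v : assoc_part n -> assoc c n v = 0.
Proof.
move=> Nn.
have h b k : centralizer b -> assoc c (b * phi k) v = 0.
  by move=> Cb; rewrite cent_cent_assoc_mul // cent_cent_assoc // amulr0.
have additive u1 u2 : assoc c u1 v = 0 -> assoc c u2 v = 0 ->
    assoc c (u1 + u2) v = 0.
  by move=> h1 h2; alg_expand_from A (eqD A h1 h2).
rewrite (mx_coord_sum Nn); do 3?apply: (additive); apply: (h);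
  exact: mx_coord_centralizer.
Qed.

(** The associator of [c] with two elements of the conjugation part lies in
    the associative part because both products do, and in the conjugation part
    because it is skew-symmetric while the product rules turn a matrix factor of
    the second or third argument into a factor on opposite sides. *)
Lemma cent_conj_assoc w w' : conj_part w -> conj_part w' -> assoc c w w' = 0.
Proof.
move=> Jw Jw'; apply: conj_part_assoc_eq0; last first.
  have sN := assoc_part_subspace; apply: (subspaceD sN); last apply: (subspaceN sN).
    by apply: conj_conj_assoc_part => //; apply: cent_mul_conj.
  by apply: cent_mul_assoc => //; apply: conj_conj_assoc_part.
have right v v' h : conj_part v -> conj_part v' ->
    assoc c v (v' * phi h) = phi h * assoc c v v'.
  move=> Jv Jv'; rewrite /associator !conj_conj_mulr //; last exact: cent_mul_conj.
  by rewrite -(centlA Cc) Cc cent_lA // amulDr amulNr.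
have left v v' h : conj_part v -> conj_part v' ->
    assoc c (v * phi h) v' = assoc c v v' * phi (mxconj h).
  move=> Jv Jv'; rewrite /associator -centrA // !conj_conj_mull //;
    last exact: cent_mul_conj.
  by rewrite -centrA // amulDl amulNl.
by move=> h; rewrite -right // assocC23 left // (assocC23 c w') amulNl aoppK.
Qed.

Lemma cent_nucleus u v : assoc c u v = 0.
Proof.
have additive1 u1 u2 u3 : assoc c u1 u3 = 0 -> assoc c u2 u3 = 0 ->
    assoc c (u1 + u2) u3 = 0.
  by move=> h1 h2; alg_expand_from A (eqD A h1 h2).
have [n [w [Nn [Jw ->]]]] := assoc_conj_decomp u.
have [n' [w' [Nn' [Jw' ->]]]] := assoc_conj_decomp v.
apply: (additive1); first exact: cent_assoc_part_assoc.
rewrite assocC23; apply: (canLR (@aoppK _ _ A)); rewrite aopp0.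
apply: (additive1); first exact: cent_assoc_part_assoc.
exact: cent_conj_assoc.
Qed.

Lemma cent_mulA u v : c * u * v = c * (u * v).
Proof. exact/(asub_eq0 A)/cent_nucleus. Qed.

Lemma cent_midA u v : u * c * v = u * (c * v).
Proof.
by apply/(asub_eq0 A); change (assoc u c v = 0); rewrite assocC12 cent_nucleus aopp0.
Qed.

Lemma cent_rmulA u v : u * v * c = u * (v * c).
Proof.
by apply/(asub_eq0 A); change (assoc u v c = 0); rewrite -assoc_rot cent_nucleus.
Qed.

End Nucleus.

(** ** The odd part *)

Definition odd_part (x : T) : Prop := conj_part x /\ x * e00 = x.

Lemma odd_part_subspace : is_subspace A odd_part.
Proof.
have sJ := conj_part_subspace; split=> [|x y [Jx xe] [Jy ye]|a x [Jx xe]].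
- by split; [apply: (subspace0 sJ)|rewrite amul0r].
- by split; [apply: (subspaceD sJ)|rewrite amulDl xe ye].
- by split; [apply: (subspaceZ sJ)|rewrite amulZl xe].
Qed.

Lemma cent_mul_odd c x : centralizer c -> odd_part x -> odd_part (c * x).
Proof.
by move=> Cc [Jx xe]; split; [apply: cent_mul_conj|rewrite centrA // xe].
Qed.

Lemma odd_e01 x : odd_part x -> x * e01 = 0.
Proof. by case=> Jx <-; rewrite conj_part_mulA // mulmx_E phi0 amulr0. Qed.

Lemma odd_e11 x : odd_part x -> x * e11 = 0.
Proof. by case=> Jx <-; rewrite conj_part_mulA // mulmx_E phi0 amulr0. Qed.

(** The product of two odd elements is [c * e01] with [c] in the centralizer;
    this [c] is their product in the Gamma-algebra. *)
Definition odd_mul (x y : T) : T := mx_coord (x * y) false true.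

Lemma odd_mul_cent x y : odd_part x -> odd_part y -> centralizer (odd_mul x y).
Proof.
by move=> [Jx _] [Jy _]; apply/mx_coord_centralizer/conj_conj_assoc_part.
Qed.

Lemma odd_mulE x y : odd_part x -> odd_part y -> odd_mul x y * e01 = x * y.
Proof.
move=> [Jx xe] [Jy ye]; set m := x * y.
have Nm : assoc_part m by apply: conj_conj_assoc_part.
have me : m * e11 = m.
  by have := conj_conj_mull Jx Jy (E F false false); rewrite xe mxconj_E.
have em : e00 * m = m.
  by have := conj_conj_mulr Jx Jy (E F false false); rewrite ye.
have mA h : m * phi h * e01 = m * phi (h *m E F false true)%R.
  by rewrite phiM; apply/(asub_eq0 A)/Nm.
have hmA h k : phi h * m * phi k * e01 = phi h * m * phi (k *m E F false true)%R.
  by rewrite phiM; apply/(asub_eq0 A)/(assoc_part_lmul h Nm).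
by rewrite /odd_mul /mx_coord -/m amulDl em mA hmA !mulmx_E /= phi0 amulr0 aaddr0.
Qed.

Lemma cent_inj_e01 c c' : centralizer c -> centralizer c' ->
  c * e01 = c' * e01 -> c = c'.
Proof.
move=> Cc Cc' ce.
have E b : centralizer b -> b = b * e01 * e10 + e10 * (b * e01).
  move=> Cb; rewrite centrA // e_mul -cent_lA // -Cb centlA // e_mul /=.
  by rewrite -amulDr e_sum amul1r.
by rewrite (E c) // ce -E.
Qed.

(** ** Multiplication table *)

Section Table.

Variables (a b x y : T) (h k : 'M[F]_2).
Hypotheses (Ca : centralizer a) (Cb : centralizer b).
Hypotheses (Ox : odd_part x) (Oy : odd_part y).

Lemma even_even_mul : a * phi h * (b * phi k) = a * b * phi (h *m k)%R.
Proof. by rewrite !cent_mulA // -(cent_midA Cb) -Cb cent_mulA // phiM. Qed.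

Lemma even_odd_mul : a * phi h * (x * phi k) = a * x * phi (mxconj h *m k)%R.
Proof.
by case: Ox => Jx _; rewrite cent_mulA // conj_part_lmul // cent_mulA.
Qed.

Lemma odd_even_mul : x * phi k * (a * phi h) = a * x * phi (h *m k)%R.
Proof.
case: Ox => Jx _.
rewrite -(cent_midA Ca) -(cent_comm_conj Ca (conj_part_mul k Jx)) cent_mulA //.
by rewrite conj_part_mulA // cent_mulA.
Qed.

Lemma odd_odd_mul :
  x * phi h * (y * phi k) =
  odd_mul x y * phi (k *m (E F false true *m mxconj h))%R.
Proof.
case: (Ox) (Oy) => [Jx _] [Jy _].
rewrite conj_conj_mulr //; last exact: conj_part_mul.
rewrite conj_conj_mull // -(odd_mulE Ox Oy).
have Cc := odd_mul_cent Ox Oy.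
by rewrite cent_mulA // -(cent_midA Cc) -Cc cent_mulA // !phiM.
Qed.

End Table.

(** ** The Gamma-algebra identities *)

Section GammaIdentities.

Variables (c x y z : T).
Hypotheses (Cc : centralizer c).
Hypotheses (Ox : odd_part x) (Oy : odd_part y) (Oz : odd_part z).

Lemma odd_comm : c * x = x * c.
Proof. by case: Ox => Jx _; apply: cent_comm_conj. Qed.

Lemma odd_mul_lcent : odd_mul (c * x) y = c * odd_mul x y.
Proof.
have Cxy := odd_mul_cent Ox Oy; have Ocx := cent_mul_odd Cc Ox.
apply: cent_inj_e01; [exact: odd_mul_cent|exact: centralizerM|].
by rewrite odd_mulE // !cent_mulA // odd_mulE.
Qed.

Lemma odd_mul_comm : c * odd_mul x y = odd_mul x y * c.
Proof.
have Cxy := odd_mul_cent Ox Oy.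
apply: cent_inj_e01; [exact: centralizerM|exact: centralizerM|].
case: (Oy) => Jy _.
rewrite (cent_mulA Cc) (odd_mulE Ox Oy) (cent_mulA Cxy) Cc -(cent_mulA Cxy).
rewrite (odd_mulE Ox Oy).
by rewrite (cent_rmulA Cc) -(cent_comm_conj Cc Jy) -(cent_midA Cc) -odd_comm cent_mulA.
Qed.

Lemma mx_coord0 i j : mx_coord 0 i j = 0.
Proof. by rewrite /mx_coord; alg A. Qed.

Lemma mx_coordD u v i j : mx_coord (u + v) i j = mx_coord u i j + mx_coord v i j.
Proof. by rewrite /mx_coord; alg A. Qed.

Lemma odd_sqr : x * x = 0.
Proof.
case: (Ox) => Jx xe; have h := assoc_xyx altA x e00.
have ex : e00 * x = 0 by rewrite Jx mxconj_E /= odd_e11.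
by rewrite /associator xe ex amulr0 in h; alg_from A h.
Qed.

Lemma odd_mulxx : odd_mul x x = 0.
Proof. by rewrite /odd_mul odd_sqr mx_coord0. Qed.

(** The associator of [x], [y] and [z * e10] evaluates to the opposite of the
    first term, its rotation to the sum of the other two. *)
Lemma odd_mul_cyclic :
  odd_mul x y * z + odd_mul y z * x + odd_mul z x * y = 0.
Proof.
have r v : v * phi 1%:M%R = v by rewrite phi1 amul1r.
have c1 := odd_mul_cent Ox Oy; have c2 := odd_mul_cent Oy Oz.
have c3 := odd_mul_cent Oz Ox.
have o1 := cent_mul_odd c1 Oz; have o2 := cent_mul_odd c2 Ox.
have o3 := cent_mul_odd c3 Oy.
have xy_z : x * y * (z * e10) = - (odd_mul x y * z).
  rewrite -(odd_mulE Ox Oy) even_odd_mul // mxconj_E /= mulNmx phiN amulNr mulmx_E /=.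
  by case: o1 => _ ->.
have y_z : y * (z * e10) = odd_mul y z * e11.
  by rewrite -[y in LHS]r odd_odd_mul // mxconj1 mulmx1 mulmx_E.
have x_yz : x * (odd_mul y z * e11) = 0.
  by rewrite -[x in LHS]r odd_even_mul // mulmx1 odd_e11.
have yz_x : odd_mul y z * e11 * x = odd_mul y z * x.
  rewrite -[x in LHS]r even_odd_mul // mulmx1 mxconj_E /=.
  by case: o2 => _ ->.
have z_x : z * e10 * x = - (odd_mul z x * e00).
  rewrite -[x in LHS]r odd_odd_mul // mul1mx mxconj_E /= mulmxN mulmx_E /=.
  by rewrite phiN amulNr.
have y_zx : y * (odd_mul z x * e00) = odd_mul z x * y.
  by rewrite -[y in LHS]r odd_even_mul // mulmx1; case: o3 => _ ->.
have := assoc_rot x y (z * e10).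
rewrite /associator xy_z y_z x_yz yz_x z_x amulNr y_zx => e.
alg_from A (eqN A e).
Qed.

End GammaIdentities.

Lemma odd_mulC x y : odd_part x -> odd_part y -> odd_mul x y + odd_mul y x = 0.
Proof.
move=> Ox Oy; rewrite /odd_mul -mx_coordD.
have Oxy := subspaceD odd_part_subspace Ox Oy.
have h : x * y + y * x = 0.
  alg_from A (eqB A (eqB A (odd_sqr Oxy) (odd_sqr Ox)) (odd_sqr Oy)).
by rewrite h mx_coord0.
Qed.

End Structure.

(** * Constructions of algebras *)

Definition prod_algebra (F : fieldType) (S T : Type) (A : algebra F S)
  (B : algebra F T) : algebra F (S * T).
Proof.
refine (@Algebra F (S * T) (azero A, azero B)
  (fun x => (aopp A x.1, aopp B x.2))
  (fun x y => (aadd A x.1 y.1, aadd B x.2 y.2))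
  (fun a x => (ascale A a x.1, ascale B a x.2)) (aone A, aone B)
  (fun x y => (amul A x.1 y.1, amul B x.2 y.2))
  _ _ _ _ _ _ _ _ _ _ _ _ _ _).
- by move=> x y z; rewrite /= !aaddA.
- by move=> x y; rewrite /= (aaddC A) (aaddC B).
- by case=> x y; rewrite /= !aadd0.
- by case=> x y; rewrite /= !aaddN.
- by move=> a b x; rewrite /= !ascaleA.
- by case=> x y; rewrite /= !ascale1.
- by move=> a x y; rewrite /= !ascaleDr.
- by move=> a b x; rewrite /= !ascaleDl.
- by case=> x y; rewrite /= !amul1l.
- by case=> x y; rewrite /= !amul1r.
- by move=> x y z; rewrite /= !amulDl.
- by move=> x y z; rewrite /= !amulDr.
- by move=> a x y; rewrite /= !amulZl.
- by move=> a x y; rewrite /= !amulZr.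
Defined.

Record bilinear_unital (F : fieldType) (T : Type) (A : algebra F T)
    (one : T) (mul : T -> T -> T) : Prop := BilinearUnital {
  bu1l : left_id one mul;
  bu1r : right_id one mul;
  buDl : left_distributive mul (aadd A);
  buDr : right_distributive mul (aadd A);
  buZl : forall a x y, mul (ascale A a x) y = ascale A a (mul x y);
  buZr : forall a x y, mul x (ascale A a y) = ascale A a (mul x y)
}.

Definition with_mul (F : fieldType) (T : Type) (A : algebra F T) (one : T)
  (mul : T -> T -> T) (h : bilinear_unital A one mul) : algebra F T :=
  @Algebra F T (azero A) (aopp A) (aadd A) (ascale A) one mul
    (aaddA A) (aaddC A) (aadd0 A) (aaddN A) (ascaleA A) (ascale1 A)
    (ascaleDr A) (ascaleDl A) (bu1l h) (bu1r h) (buDl h) (buDr h)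
    (buZl h) (buZr h).

Section SubAlgebra.

Variables (F : fieldType) (T : Type) (A : algebra F T) (P : T -> Prop).

Record is_subalgebra : Prop := IsSubalgebra {
  subalg_subspace : is_subspace A P;
  subalg1 : P (aone A);
  subalgM : forall x y, P x -> P y -> P (amul A x y)
}.

Hypothesis sP : is_subalgebra.

Let sV := subalg_subspace sP.

Definition sub_algebra : algebra F {x | P x}.
Proof.
refine (@Algebra F {x | P x} (exist _ _ (subspace0 sV))
  (fun x => exist _ _ (subspaceN sV (proj2_sig x)))
  (fun x y => exist _ _ (subspaceD sV (proj2_sig x) (proj2_sig y)))
  (fun a x => exist _ _ (subspaceZ sV a (proj2_sig x)))
  (exist _ _ (subalg1 sP))
  (fun x y => exist _ _ (subalgM sP (proj2_sig x) (proj2_sig y)))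
  _ _ _ _ _ _ _ _ _ _ _ _ _ _).
- by move=> *; apply: eq_exist; apply: aaddA.
- by move=> *; apply: eq_exist; apply: aaddC.
- by case=> *; apply: eq_exist; apply: aadd0.
- by case=> *; apply: eq_exist; apply: aaddN.
- by move=> *; apply: eq_exist; apply: ascaleA.
- by case=> *; apply: eq_exist; apply: ascale1.
- by move=> *; apply: eq_exist; apply: ascaleDr.
- by move=> *; apply: eq_exist; apply: ascaleDl.
- by case=> *; apply: eq_exist; apply: amul1l.
- by case=> *; apply: eq_exist; apply: amul1r.
- by move=> *; apply: eq_exist; apply: amulDl.
- by move=> *; apply: eq_exist; apply: amulDr.
- by move=> *; apply: eq_exist; apply: amulZl.
- by move=> *; apply: eq_exist; apply: amulZr.
Defined.

End SubAlgebra.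

Lemma val_inj_sig (T : Type) (P : T -> Prop) (x y : {x | P x}) :
  sval x = sval y -> x = y.
Proof. by case: x y => [x px] [y py] /= e; apply: eq_exist. Qed.

(** * Homomorphisms, transport and rigidity *)

Section Homs.

Variables (F : fieldType) (S T : Type) (A : algebra F S) (B : algebra F T).
Variable f : S -> T.
Hypothesis hf : is_unital_hom A B f.

Lemma hom0 : f (azero A) = azero B.
Proof. by rewrite -(ascale0r A (azero A)) (homZ hf) ascale0r. Qed.

Lemma homN x : f (aopp A x) = aopp B (f x).
Proof. by rewrite -ascaleN1 (homZ hf) ascaleN1. Qed.

Lemma homB x y : f (asub A x y) = asub B (f x) (f y).
Proof. by rewrite /asub (homD hf) homN. Qed.

Lemma hom_inv g : cancel f g -> cancel g f -> is_unital_hom B A g.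
Proof.
by move=> fK gK; split=> [x y|a x|x y|]; apply: (can_inj fK);
  rewrite ?(homD hf, homZ hf, homM hf, hom1 hf) !gK.
Qed.

End Homs.

Lemma hom_comp (F : fieldType) (S T U : Type) (A : algebra F S)
    (B : algebra F T) (C : algebra F U) g f :
  is_unital_hom B C g -> is_unital_hom A B f -> is_unital_hom A C (g \o f).
Proof.
by move=> [gD gZ gM g1] [fD fZ fM f1]; split=> *; rewrite /= ?fD ?fZ ?fM ?f1.
Qed.

Section Transport.

Variables (F : fieldType) (S T : Type) (f : S -> T) (g : T -> S).
Hypotheses (fK : cancel f g) (gK : cancel g f).

Definition transport_algebra (A : algebra F S) : algebra F T.
Proof.
refine (@Algebra F T (f (azero A)) (fun x => f (aopp A (g x)))
  (fun x y => f (aadd A (g x) (g y))) (fun a x => f (ascale A a (g x)))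
  (f (aone A)) (fun x y => f (amul A (g x) (g y)))
  _ _ _ _ _ _ _ _ _ _ _ _ _ _);
  repeat (move=> ?); rewrite ?fK.
- by rewrite aaddA.
- by rewrite aaddC.
- by rewrite aadd0 gK.
- by rewrite aaddN.
- by rewrite ascaleA.
- by rewrite ascale1 gK.
- by rewrite ascaleDr.
- by rewrite ascaleDl.
- by rewrite amul1l gK.
- by rewrite amul1r gK.
- by rewrite amulDl.
- by rewrite amulDr.
- by rewrite amulZl.
- by rewrite amulZr.
Defined.

Lemma transport_hom A : is_unital_hom A (transport_algebra A) f.
Proof. by split=> *; rewrite /= ?fK. Qed.

Lemma transport_alternative A : alternative A -> alternative (transport_algebra A).
Proof.
move=> altA x y; have h := hom_inv (transport_hom A) fK gK.
by split; apply: (can_inj gK); rewrite /associator !(homB h, homM h) (hom0 h);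
  have [h1 h2] := altA (g x) (g y).
Qed.

End Transport.

(** Objects on the same set are to be compared by equality, which here comes
    down to equality of the operations. *)
Lemma algebra_rigid (F : fieldType) (T : Type) (A B : algebra F T) :
  is_unital_hom A B id -> A = B.
Proof.
move=> h; have h0 := hom0 h; have hN := homN h; case: h => hD hZ hM h1.
case: A B hD hZ hM h1 h0 hN =>
  [z o a s u m p1 p2 p3 p4 p5 p6 p7 p8 p9 p10 p11 p12 p13 p14]
  [z' o' a' s' u' m' q1 q2 q3 q4 q5 q6 q7 q8 q9 q10 q11 q12 q13 q14] /=.
move=> hD hZ hM h1 h0 hN.
have ? : a = a' by apply/funext=> x; apply/funext=> y; apply: hD.
have ? : s = s' by apply/funext=> x; apply/funext=> y; apply: hZ.
have ? : m = m' by apply/funext=> x; apply/funext=> y; apply: hM.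
have ? : o = o' by apply/funext.
subst; have pi := Prop_irrelevance.
rewrite (pi _ p1 q1) (pi _ p2 q2) (pi _ p3 q3) (pi _ p4 q4) (pi _ p5 q5).
rewrite (pi _ p6 q6) (pi _ p7 q7) (pi _ p8 q8) (pi _ p9 q9) (pi _ p10 q10).
by rewrite (pi _ p11 q11) (pi _ p12 q12) (pi _ p13 q13) (pi _ p14 q14).
Qed.

(** * Identities of degree three in a Gamma-algebra *)

Section GammaCalculus.

Variables (F : fieldType) (T : Type) (G : gamma_algebra F T).

Local Notation A := (gamma_alg G).
Local Notation "0" := (azero A).
Local Notation "1" := (aone A).
Local Notation "- x" := (aopp A x).
Local Notation "x + y" := (aadd A x y).
Local Notation "x - y" := (asub A x y).
Local Notation "x * y" := (amul A x y).
Local Notation even := (gpart G false).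
Local Notation odd := (gpart G true).

Lemma gamma_mulA a u v : even a -> a * u * v = a * (u * v).
Proof. by move=> ea; apply/(asub_eq0 A)/gamma_even_nucl. Qed.

Lemma gamma_comm a x : even a -> odd x -> x * a = a * x.
Proof. by move=> ea ox; apply/esym/(asub_eq0 A)/gamma_even_odd_comm. Qed.

Lemma gamma_even_odd a x : even a -> odd x -> odd (a * x).
Proof. exact: gpart_mul. Qed.

Lemma gamma_odd_odd x y : odd x -> odd y -> even (x * y).
Proof. exact: gpart_mul. Qed.

Lemma gamma_even_even a b : even a -> even b -> even (a * b).
Proof. exact: gpart_mul. Qed.

Lemma gamma_skew x y : odd x -> odd y -> y * x = - (x * y).
Proof. by move=> ox oy; apply: aoppP; apply: gamma_odd_skew. Qed.

(** Away from characteristic two the square of an odd element vanishes because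
    twice it does. *)
Lemma gamma_sqr x : odd x -> x * x = 0.
Proof.
move=> ox; have [c2|c2] := boolP (2%N \in [pchar F]%R); first exact: gamma_odd_alt.
have n2 : (2%:R != 0 :> F)%R by apply: contra c2 => h; apply/andP.
have h : ascale A 2%:R%R (x * x) = 0.
  by rewrite mulr2n ascaleDl ascale1; apply: gamma_odd_skew.
by rewrite -[x * x in LHS](ascale1 A) -(mulVf n2) -ascaleA h ascaler0.
Qed.

Lemma gamma_eo_swap a b x : even a -> even b -> odd x -> a * (b * x) = b * (a * x).
Proof.
move=> ea eb ox; rewrite -(gamma_comm eb (gamma_even_odd ea ox)) gamma_mulA //.
by rewrite (gamma_comm eb ox).
Qed.

Lemma gamma_center a x y : even a -> odd x -> odd y -> x * y * a = a * (x * y).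
Proof.
move=> ea ox oy; have [_ [h _]] := gamma_odd_center ox oy.
exact/(asub_eq0 A)/h.
Qed.

Lemma gamma_odd_slide a x y : even a -> odd x -> odd y -> x * (a * y) = a * (x * y).
Proof.
move=> ea ox oy; have oay := gamma_even_odd ea oy.
by rewrite (gamma_skew oay ox) gamma_mulA // (gamma_skew ox oy) amulNr aoppK.
Qed.

Section NormalForm.

Variable grade : nat -> bool.

Local Notation M i j := (MMul i j).
Local Notation V i := (MVar i).

Definition nf_skew (f : mono -> mono) i j : poly_mono :=
  if i == j then [::] else if (i < j)%N then [:: (false, f (M (V i) (V j)))]
  else [:: (true, f (M (V j) (V i)))].

Definition nf_act i j k : poly_mono :=
  [:: (false, if (i <= j)%N then M (V i) (M (V j) (V k)) else M (V j) (M (V i) (V k)))].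

Definition nf_ordered i j k : poly_mono :=
  if (i < k)%N && (k < j)%N then
    [:: (false, M (M (V i) (V k)) (V j)); (false, M (M (V k) (V j)) (V i))]
  else [:: (false, M (M (V i) (V j)) (V k))].

Definition nf_odd i j k : poly_mono :=
  if i == j then [::] else if (i < j)%N then nf_ordered i j k
  else popp (nf_ordered j i k).

(** Even atoms act on the left and are sorted, products of two odd atoms are
    sorted up to sign, and of the three rotations of a product of distinct odd
    atoms the one with the extreme atoms multiplied first is eliminated. *)
Definition nf_gamma (s : mono) : poly_mono :=
  match s with
  | MMul (MMul (MVar i) (MVar j)) (MVar k) =>
      match grade i, grade j, grade k with
      | false, false, false => [:: (false, M (V i) (M (V j) (V k)))]
      | false, false, true => nf_act i j k
      | false, true, false => nf_act i k j
      | true, false, false => nf_act j k i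
      | false, true, true => nf_skew (MMul (V i)) j k
      | true, false, true => nf_skew (MMul (V j)) i k
      | true, true, false => nf_skew (MMul (V k)) i j
      | true, true, true => nf_odd i j k
      end
  | MMul (MVar i) (MMul (MVar j) (MVar k)) =>
      match grade i, grade j, grade k with
      | false, false, false => [:: (false, s)]
      | false, false, true => nf_act i j k
      | false, true, false => nf_act i k j
      | true, false, false => nf_act j k i
      | false, true, true => nf_skew (MMul (V i)) j k
      | true, false, true => nf_skew (MMul (V j)) i k
      | true, true, false => nf_skew (MMul (V k)) i j
      | true, true, true => nf_odd j k i
      end
  | _ => [:: (false, s)]
  end.

Variable env : nat -> T.
Hypothesis envP : forall i, gpart G (grade i) (env i).

Let evenP i : grade i = false -> even (env i).
Proof. by move=> <-. Qed.

Let oddP i : grade i = true -> odd (env i).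
Proof. by move=> <-. Qed.

Lemma peval1 s : peval A env [:: (false, s)] = meval A env s.
Proof. exact: aaddr0. Qed.

Lemma nf_actP i j k : grade i = false -> grade j = false -> grade k = true ->
  peval A env (nf_act i j k) = env i * (env j * env k).
Proof.
move=> gi gj gk; rewrite peval1; case: ifP => //= _.
by apply: gamma_eo_swap; [apply: evenP|apply: evenP|apply: oddP].
Qed.

Lemma nf_skewP i j k : grade j = true -> grade k = true ->
  peval A env (nf_skew (MMul (V i)) j k) = env i * (env j * env k).
Proof.
move=> gj gk; rewrite /nf_skew; case: eqP => [->|_].
  by rewrite /= gamma_sqr ?amulr0 //; apply: oddP.
case: ifP => _; rewrite /= /seval /= aaddr0 //.
by rewrite (gamma_skew (oddP gj) (oddP gk)) amulNr aoppK.
Qed.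

Lemma nf_orderedP i j k : grade i = true -> grade j = true -> grade k = true ->
  peval A env (nf_ordered i j k) = env i * env j * env k.
Proof.
move=> gi gj gk; rewrite /nf_ordered; case: ifP => _; rewrite /= /seval /= aaddr0 //.
have e := gamma_odd_cyclic (oddP gi) (oddP gk) (oddP gj).
rewrite (gamma_skew (oddP gi) (oddP gj)) in e.
alg_from A e.
Qed.

Lemma nf_oddP i j k : grade i = true -> grade j = true -> grade k = true ->
  peval A env (nf_odd i j k) = env i * env j * env k.
Proof.
move=> gi gj gk; rewrite /nf_odd; case: eqP => [->|_].
  by rewrite /= gamma_sqr ?amul0r //; apply: oddP.
case: ifP => _; rewrite ?peval_opp nf_orderedP //.
by rewrite (gamma_skew (oddP gi) (oddP gj)) amulNl aoppK.
Qed.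

Lemma nf_gammaP s : peval A env (nf_gamma s) = meval A env s.
Proof.
rewrite /nf_gamma; case: s => [|i|]; [exact: peval1|exact: peval1|].
case=> [|i|[|i|? ?] [|j|? ?]] [|k|[|k|? ?] [|l|? ?]]; rewrite ?peval1 //.
- case gi: (grade i); case gk: (grade k); case gl: (grade l);
  rewrite ?nf_actP ?nf_skewP ?nf_oddP ?peval1 //=.
  + by rewrite (gamma_comm (gamma_odd_odd (oddP gk) (oddP gl)) (oddP gi)).
  + by rewrite (gamma_comm (evenP gl) (oddP gk)) (gamma_odd_slide (evenP gl)) //; apply: oddP.
  + by rewrite (gamma_odd_slide (evenP gk)) //; apply: oddP.
  + rewrite (gamma_comm (gamma_even_even (evenP gk) (evenP gl)) (oddP gi)).
    by rewrite (gamma_mulA _ _ (evenP gk)).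
  + by rewrite (gamma_comm (evenP gl) (oddP gk)).
- case gi: (grade i); case gj: (grade j); case gk: (grade k);
  rewrite ?nf_actP ?nf_skewP ?nf_oddP ?peval1 //=.
  + by rewrite (gamma_center (evenP gk)) //; apply: oddP.
  + rewrite (gamma_comm (evenP gj) (oddP gi)) (gamma_mulA _ _ (evenP gj)) //.
  + rewrite (gamma_comm (evenP gj) (oddP gi)) (gamma_mulA _ _ (evenP gj)).
    by rewrite (gamma_comm (evenP gk) (oddP gi)).
  + by rewrite (gamma_mulA _ _ (evenP gi)).
  + by rewrite (gamma_mulA _ _ (evenP gi)) (gamma_comm (evenP gk) (oddP gj)).
  + by rewrite (gamma_mulA _ _ (evenP gi)).
  + by rewrite (gamma_mulA _ _ (evenP gi)).
Qed.

End NormalForm.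

(** Even atoms are numbered first, so that the index of an atom gives its grade. *)
Lemma gamma_eqP (ea ox : seq T) e1 e2 :
  (forall i, even (nth 0 ea i)) -> (forall i, odd (nth 0 ox i)) ->
  let env := nth 0 (ea ++ ox) in
  decide_eq (nf_gamma (leq (size ea))) e1 e2 -> eval A env e1 = eval A env e2.
Proof.
move=> eP oP env; apply: decide_eqP; apply: nf_gammaP => i; rewrite /env nth_cat.
by rewrite leqNgt; case: ltnP => _; [apply: eP|apply: oP].
Qed.

End GammaCalculus.

(** * The alternative algebra of a Gamma-algebra *)

Section ZornAlgebra.

Variables (F : fieldType) (T : Type) (G : gamma_algebra F T).

Local Notation A := (gamma_alg G).
Local Notation "0" := (azero A).
Local Notation "1" := (aone A).
Local Notation "- x" := (aopp A x).
Local Notation "x + y" := (aadd A x y).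
Local Notation "x - y" := (asub A x y).
Local Notation "x * y" := (amul A x y).
Local Notation even := (gpart G false).
Local Notation odd := (gpart G true).

Definition six : Type := ((T * T) * (T * T)) * (T * T).

(** [(((a, b), (c, d)), (x, y))] stands for the matrix [m] with rows [(a, b)] and
    [(c, d)] plus the column [v] with entries [x] and [y].  The product of [v] by
    [m] on the right is the column [m v], on the left it is [m' v] with [m'] the
    adjugate of [m]; the product of the columns [v] and [v'] is the matrix with
    rows [(- y x', x x')] and [(- y y', x y')].  On all sextuples, of whatever
    grade, this is a unital bilinear product, and the algebra wanted is the
    subalgebra of those with matrix entries even and column entries odd. *)
Definition six_mul (s t : six) : six :=
  let: (((a, b), (c, d)), (x, y)) := s in
  let: (((a', b'), (c', d')), (x', y')) := t in
  (((a * a' + b * c' - y * x', a * b' + b * d' + x * x'),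
    (c * a' + d * c' - y * y', c * b' + d * d' + x * y')),
   (d * x' - b * y' + a' * x + b' * y, a * y' - c * x' + c' * x + d' * y)).

Definition six_one : six := (((1, 0), (0, 1)), (0, 0)).

Let V := prod_algebra (prod_algebra (prod_algebra A A) (prod_algebra A A))
  (prod_algebra A A).

Lemma six_bilinear : bilinear_unital V six_one six_mul.
Proof.
split.
- move=> [[[a b] [c d]] [x y]]; rewrite /six_mul /=; repeat congr pair; alg A.
- move=> [[[a b] [c d]] [x y]]; rewrite /six_mul /=; repeat congr pair; alg A.
- move=> [[[a b] [c d]] [x y]] [[[a' b'] [c' d']] [x' y']].
  move=> [[[a'' b''] [c'' d'']] [x'' y'']].
  rewrite /six_mul /=; repeat congr pair; alg A.
- move=> [[[a b] [c d]] [x y]] [[[a' b'] [c' d']] [x' y']].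
  move=> [[[a'' b''] [c'' d'']] [x'' y'']].
  rewrite /six_mul /=; repeat congr pair; alg A.
- move=> s [[[a b] [c d]] [x y]] [[[a' b'] [c' d']] [x' y']].
  by rewrite /six_mul /asub /= !(amulZl, amulZr, ascalerN, ascaleDr).
- move=> s [[[a b] [c d]] [x y]] [[[a' b'] [c' d']] [x' y']].
  by rewrite /six_mul /asub /= !(amulZl, amulZr, ascalerN, ascaleDr).
Qed.

Definition six_algebra : algebra F six := with_mul six_bilinear.

Definition six_part (s : six) : Prop :=
  let: (((a, b), (c, d)), (x, y)) := s in
  [/\ even a, even b, even c & even d] /\ odd x /\ odd y.

Lemma six_subalgebra : is_subalgebra six_algebra six_part.
Proof.
have e0 i := subspace0 (gpart_subspace G i).
have eD i := subspaceD (gpart_subspace G i).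
have eN i u := @subspaceN _ _ _ _ u (gpart_subspace G i).
have eZ i := subspaceZ (gpart_subspace G i).
have ee := @gamma_even_even _ _ G; have eo := @gamma_even_odd _ _ G.
have oo := @gamma_odd_odd _ _ G.
split; [split| |].
- by do !split.
- move=> [[[a b] [c d]] [x y]] [[[a' b'] [c' d']] [x' y']].
  by move=> [[? ? ? ?] [? ?]] [[? ? ? ?] [? ?]]; do !split; apply: eD.
- move=> s [[[a b] [c d]] [x y]].
  by move=> [[? ? ? ?] [? ?]]; do !split; apply: eZ.
- by do !split; try exact: e0; apply: gamma_even1.
move=> [[[a b] [c d]] [x y]] [[[a' b'] [c' d']] [x' y']].
move=> [[? ? ? ?] [? ?]] [[? ? ? ?] [? ?]].
do !split; rewrite /= /asub; repeat (apply: (eD) || apply: (eN));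
  by [apply: ee|apply: eo|apply: oo].
Qed.

Lemma six_alternative s t : six_part s -> six_part t ->
  associator six_algebra s s t = azero six_algebra /\
  associator six_algebra t s s = azero six_algebra.
Proof.
move: s t => [[[a b] [c d]] [x y]] [[[a' b'] [c' d']] [x' y']].
move=> [[ea eb ec ed] [ox oy]] [[ea' eb' ec' ed'] [ox' oy']].
pose le := [:: a; b; c; d; a'; b'; c'; d']; pose lo := [:: x; y; x'; y'].
have eP i : even (nth 0 le i).
  do 8?[case: i => [|i] //]; rewrite /le /= ?nth_nil.
  exact: (subspace0 (gpart_subspace G _)).
have oP i : odd (nth 0 lo i).
  do 4?[case: i => [|i] //]; rewrite /lo /= ?nth_nil.
  exact: (subspace0 (gpart_subspace G _)).
have ok e1 e2 := @gamma_eqP _ _ G le lo e1 e2 eP oP.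
split; rewrite /associator /asub /=; repeat congr pair.
all: match goal with |- ?u = ?v =>
  let l := constr:([:: a; b; c; d; a'; b'; c'; d'; x; y; x'; y']) in
  let R := constr:(A) in
  let p := reify_expr R l u in let q := reify_expr R l v in
  refine (ok p q _); vm_compute; reflexivity end.
Qed.

Definition zorn_carrier : Type := {s : six | six_part s}.

Definition zorn_algebra : algebra F zorn_carrier := sub_algebra six_subalgebra.

End ZornAlgebra.

Section ZornM2.

Variables (F : fieldType) (T : Type) (G : gamma_algebra F T).

Local Notation A := (gamma_alg G).
Local Notation "0" := (azero A).
Local Notation "1" := (aone A).
Local Notation "a *: x" := (ascale A a x).

Lemma zorn_alternative : alternative (zorn_algebra G).
Proof.
move=> [s ps] [t pt]; have [h1 h2] := six_alternative ps pt.
by split; apply: val_inj_sig.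
Qed.

Definition scalar_six (h : 'M[F]_2) : six T :=
  (((h (bit false) (bit false) *: 1, h (bit false) (bit true) *: 1),
    (h (bit true) (bit false) *: 1, h (bit true) (bit true) *: 1)), (0, 0)).

Lemma scalar_six_part h : six_part G (scalar_six h).
Proof.
have e0 := subspace0 (gpart_subspace G true).
have eZ a := subspaceZ (gpart_subspace G false) a (gamma_even1 G).
by do !split; try exact: e0; apply: eZ.
Qed.

Definition zorn_phi (h : 'M[F]_2) : zorn_carrier G :=
  exist _ _ (scalar_six_part h).

Lemma zorn_phi_hom : is_unital_hom (mx2_algebra F) (zorn_algebra G) zorn_phi.
Proof.
split=> [h k|s h|h k|]; apply: val_inj_sig; rewrite /= /scalar_six.
- by rewrite !mxE !ascaleDl aadd0.
- by rewrite !mxE !ascaleA ascaler0.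
- rewrite !mxE !sum_bit !ascaleDl !(amulZl, amulZr) !amul1l !ascaleA.
  by rewrite !(amul0r, amulr0) !ascaler0 /asub !aopp0 !aaddr0.
- by rewrite !mxE /= !ascale0r !ascale1.
Qed.

Definition zorn_M2 : M2_algebra F (zorn_carrier G) :=
  @M2Algebra F _ (zorn_algebra G) zorn_alternative zorn_phi zorn_phi_hom.

End ZornM2.

(** * The Gamma-algebra of an alternative algebra over matrices *)

Section GammaOf.

Variables (F : fieldType) (T : Type) (B : M2_algebra F T).

Local Notation A := (M2_alg B).
Local Notation "0" := (azero A).
Local Notation "1" := (aone A).
Local Notation "- x" := (aopp A x).
Local Notation "x + y" := (aadd A x y).
Local Notation "x - y" := (asub A x y).
Local Notation "x * y" := (amul A x y).
Local Notation "a *: x" := (ascale A a x).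

Definition pair_mul (p q : T * T) : T * T :=
  (p.1 * q.1 + odd_mul B p.2 q.2, p.1 * q.2 + q.1 * p.2).

Lemma pair_bilinear : bilinear_unital (prod_algebra A A) (1, 0) pair_mul.
Proof.
rewrite /pair_mul /odd_mul /mx_coord.
split=> [[a x]|[a x]|[a x] [b y] [c z]|[a x] [b y] [c z]|s [a x] [b y]|s [a x] [b y]] /=;
  congr pair; try by alg A.
all: by rewrite !(amulZl, amulZr) !ascaleDr.
Qed.

Definition pair_algebra : algebra F (T * T) := with_mul pair_bilinear.

Definition pair_part (p : T * T) : Prop := centralizer B p.1 /\ odd_part B p.2.

Lemma pair_subalgebra : is_subalgebra pair_algebra pair_part.
Proof.
have sC := centralizer_subspace B; have sO := odd_part_subspace B.
split; [split| |].
- by split; [apply: subspace0 sC|apply: subspace0 sO].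
- by move=> p q [? ?] [? ?]; split; [apply: (subspaceD sC)|apply: (subspaceD sO)].
- by move=> a p [? ?]; split; [apply: (subspaceZ sC)|apply: (subspaceZ sO)].
- by split; [move=> h; rewrite /= amul1l amul1r|apply: subspace0 sO].
move=> p q [cp op] [cq oq]; split.
  by apply: (subspaceD sC); [apply: centralizerM|apply: odd_mul_cent].
by apply: (subspaceD sO); apply: cent_mul_odd.
Qed.

Definition gamma_carrier : Type := {p : T * T | pair_part p}.

Local Notation K := (sub_algebra pair_subalgebra).

Definition gamma_part (i : bool) (p : gamma_carrier) : Prop :=
  if i then (sval p).1 = 0 else (sval p).2 = 0.

Lemma odd_mul0l x : odd_mul B 0 x = 0.
Proof. by rewrite /odd_mul amul0r mx_coord0. Qed.

Lemma odd_mul0r x : odd_mul B x 0 = 0.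
Proof. by rewrite /odd_mul amulr0 mx_coord0. Qed.

Lemma gamma_part_assoc p q r : gamma_part false p -> gamma_part false q ->
  gamma_part false r -> associator K p q r = azero K.
Proof.
case: p q r => [[a x] [Ca Ox]] [[b y] [Cb Oy]] [[c z] [Cc Oz]]; rewrite /gamma_part /=.
move=> x0 y0 z0; apply: val_inj_sig; rewrite /= x0 y0 z0.
rewrite !(odd_mul0l, odd_mul0r) !amulr0 !aaddr0 /= cent_mulA //; congr pair; alg A.
Qed.

Definition gamma_of : gamma_algebra F gamma_carrier.
Proof.
refine (@GammaAlgebra F gamma_carrier K gamma_part _ _ _ _ _ _ _ _ _ _ _ _).
- move=> i; split=> [|p q|a p]; rewrite /gamma_part; case: i => //=.
  + by move=> -> ->; rewrite aadd0.
  + by move=> -> ->; rewrite aadd0.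
  + by move=> ->; rewrite ascaler0.
  + by move=> ->; rewrite ascaler0.
- case=> -[c x] [/= Cc Ox].
  have c0 : pair_part (c, 0) by split=> //; apply: subspace0 (odd_part_subspace B).
  have x0 : pair_part (0, x) by split=> //; apply: subspace0 (centralizer_subspace B).
  exists (exist _ _ c0), (exist _ _ x0); do !split=> //.
  by apply: val_inj_sig; rewrite /= aadd0 aaddr0.
- by case=> -[c x] p; rewrite /gamma_part /= => x0 c0; apply: val_inj_sig; rewrite /= x0 c0.
- move=> i j [[c x] p] [[c' x'] p']; rewrite /gamma_part /=.
  by case: i; case: j => /= -> ->; rewrite ?odd_mul0l ?odd_mul0r ?amul0r ?amulr0 ?aadd0.
- by [].
- exact: gamma_part_assoc.
- move=> [[a x] [Ca Ox]] [[b y] [Cb Oy]]; rewrite /gamma_part /=.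
  move=> x0 y0; apply: val_inj_sig; rewrite /= x0 y0.
  rewrite !(odd_mul0l, odd_mul0r); congr pair; alg A.
- move=> [[a x] [/= Ca Ox]] [[b y] [/= Cb Oy]] [[c z] [/= Cc Oz]].
  rewrite /gamma_part /= => x0; apply: val_inj_sig.
  rewrite /= x0 !(odd_mul0l, odd_mul0r, amul0r, amulr0, aaddr0).
  congr pair; apply/(asub_eq0 A).
    by rewrite odd_mul_lcent // cent_mulA // -amulDr.
  rewrite cent_mulA // (odd_comm Cc (cent_mul_odd Ca Oy)) cent_mulA //.
  by rewrite -(odd_comm Cc Oy) -amulDr.
- move=> [[a x] [/= Ca Ox]] [[b y] [/= Cb Oy]].
  rewrite /gamma_part /= => a0 b0.
  have xy : gamma_part false (amul K (exist _ (a, x) (conj Ca Ox))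
      (exist _ (b, y) (conj Cb Oy))).
    by rewrite /gamma_part /= a0 b0; alg A.
  split=> //; split=> [[[c z] [/= Cc Oz]]|p q ep eq]; last first.
    by split; [|split]; apply: gamma_part_assoc.
  rewrite /gamma_part /= => z0; apply: val_inj_sig.
  rewrite /= a0 b0 z0 !(amulr0, amul0r, aaddr0, aadd0, odd_mul0l, odd_mul0r).
  by congr pair; [apply/(asub_eq0 A)/esym/odd_mul_comm|exact: aopp0].
- move=> [[a x] [/= Ca Ox]] [[b y] [/= Cb Oy]].
  rewrite /gamma_part /= => a0 b0; apply: val_inj_sig.
  by rewrite /= a0 b0 !(amul0r, aadd0) odd_mulC.
- move=> _ [[a x] [/= Ca Ox]]; rewrite /gamma_part /= => a0; apply: val_inj_sig.
  by rewrite /= a0 /pair_mul /= !(amul0r, aadd0) odd_mulxx.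
- move=> [[a x] [/= Ca Ox]] [[b y] [/= Cb Oy]] [[c z] [/= Cc Oz]].
  rewrite /gamma_part /= => a0 b0 c0; apply: val_inj_sig.
  rewrite /= a0 b0 c0 !(amulr0, amul0r, aaddr0, aadd0, odd_mul0l).
  by rewrite odd_mul_cyclic.
Defined.

Definition gfst (p : gamma_carrier) : T := (sval p).1.
Definition gsnd (p : gamma_carrier) : T := (sval p).2.

Lemma gfst_cent p : centralizer B (gfst p).
Proof. by case: p => p []. Qed.

Lemma gsnd_odd p : odd_part B (gsnd p).
Proof. by case: p => p []. Qed.

Lemma gpair_inj p q : gfst p = gfst q -> gsnd p = gsnd q -> p = q.
Proof.
rewrite /gfst /gsnd => e1 e2; apply: val_inj_sig.
by rewrite [LHS]surjective_pairing e1 e2 -surjective_pairing.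
Qed.

Lemma gamma_partE i p : gpart gamma_of i p = ((if i then gfst p else gsnd p) = 0).
Proof. by case: i. Qed.

Lemma gfst_surj c : centralizer B c ->
  exists2 p, gpart gamma_of false p & gfst p = c.
Proof.
move=> Cc; have p : pair_part (c, 0).
  by split=> //; apply: (subspace0 (odd_part_subspace B)).
by exists (exist _ _ p).
Qed.

Lemma gsnd_surj x : odd_part B x ->
  exists2 p, gpart gamma_of true p & gsnd p = x.
Proof.
move=> Ox; have p : pair_part (0, x).
  by split=> //; apply: (subspace0 (centralizer_subspace B)).
by exists (exist _ _ p).
Qed.

Lemma gfst0 : gfst (azero gamma_of) = 0. Proof. by []. Qed.
Lemma gsnd0 : gsnd (azero gamma_of) = 0. Proof. by []. Qed.
Lemma gfst1 : gfst (aone gamma_of) = 1. Proof. by []. Qed.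
Lemma gsnd1 : gsnd (aone gamma_of) = 0. Proof. by []. Qed.

Lemma gfstD p q : gfst (aadd gamma_of p q) = gfst p + gfst q.
Proof. by []. Qed.

Lemma gsndD p q : gsnd (aadd gamma_of p q) = gsnd p + gsnd q.
Proof. by []. Qed.

Lemma gfstB p q : gfst (asub gamma_of p q) = gfst p - gfst q.
Proof. by []. Qed.

Lemma gsndB p q : gsnd (asub gamma_of p q) = gsnd p - gsnd q.
Proof. by []. Qed.

Lemma gfstZ s p : gfst (ascale gamma_of s p) = s *: gfst p.
Proof. by []. Qed.

Lemma gsndZ s p : gsnd (ascale gamma_of s p) = s *: gsnd p.
Proof. by []. Qed.

Lemma gfstM p q :
  gfst (amul gamma_of p q) = gfst p * gfst q + odd_mul B (gsnd p) (gsnd q).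
Proof. by []. Qed.

Lemma gsndM p q :
  gsnd (amul gamma_of p q) = gfst p * gsnd q + gfst q * gsnd p.
Proof. by []. Qed.

End GammaOf.

Arguments gamma_of : simpl never.
Arguments gfst : simpl never.
Arguments gsnd : simpl never.

Definition gvalE := (gfst0, gsnd0, gfst1, gsnd1, gfstD, gsndD, gfstB, gsndB,
  gfstZ, gsndZ, gfstM, gsndM).

(** * Coordinatization *)

Section Coordinatization.

Variables (F : fieldType) (T : Type) (B : M2_algebra F T).

Local Notation A := (M2_alg B).
Local Notation "0" := (azero A).
Local Notation "1" := (aone A).
Local Notation "- x" := (aopp A x).
Local Notation "x + y" := (aadd A x y).
Local Notation "x - y" := (asub A x y).
Local Notation "x * y" := (amul A x y).
Local Notation "a *: x" := (ascale A a x).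
Local Notation phi := (M2_phi B).
Local Notation e i j := (phi (E F i j)).
Local Notation e00 := (e false false).
Local Notation e01 := (e false true).
Local Notation e10 := (e true false).
Local Notation e11 := (e true true).

Definition assemble (a b c d x y : T) : T :=
  a * e00 + b * e01 + c * e10 + d * e11 + x + y * e10.

Definition assemble_six (s : six (gamma_carrier B)) : T :=
  let: (((a, b), (c, d)), (x, y)) := s in
  assemble (gfst a) (gfst b) (gfst c) (gfst d) (gsnd x) (gsnd y).

Definition coordinatize (s : zorn_carrier (gamma_of B)) : T :=
  assemble_six (sval s).

Lemma odd_e x i j : odd_part B x ->
  x * e i j = if j then 0 else if i then x * e10 else x.
Proof.
move=> Ox; case: i; case: j => //; first exact: odd_e11; first exact: odd_e01.
exact: (proj2 Ox).
Qed.

Section Products.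

Variables u v x y : T.
Hypotheses (Cu : centralizer B u) (Cv : centralizer B v).
Hypotheses (Ox : odd_part B x) (Oy : odd_part B y).

Let phi1r z : z = z * phi 1%:M%R.
Proof. by rewrite phi1 amul1r. Qed.

Let Oux : odd_part B (u * x).
Proof. exact: cent_mul_odd. Qed.

Lemma mul_even_even i j k l :
  u * e i j * (v * e k l) = if j == k then u * v * e i l else 0.
Proof.
by rewrite even_even_mul // mulmx_E; case: eqP => // _; rewrite phi0 amulr0.
Qed.

Lemma mul_even_odd i j :
  u * e i j * x = if j then if i then u * x else 0
                  else if i then - (u * x * e10) else 0.
Proof.
rewrite [x in LHS]phi1r even_odd_mul // mulmx1 mxconj_E.
by case: i; case: j => /=; rewrite ?phiN ?amulNr odd_e // aopp0.
Qed.

Lemma mul_even_odd_e10 i j :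
  u * e i j * (x * e10) = if i then 0 else if j then - (u * x) else u * x * e10.
Proof.
have -> : u * e i j * (x * e10) = u * x * phi (mxconj (E F i j) *m E F true false)%R.
  exact: even_odd_mul.
have -> : (mxconj (E F i j) *m E F true false)%R =
    (if i then 0 else if j then - E F false false else E F true false)%R.
  by rewrite mxconj_E; case: i; case: j; rewrite /= ?mulNmx mulmx_E ?oppr0.
by case: i; [|case: j]; rewrite ?phi0 ?phiN ?amulNr ?amulr0 ?(odd_e _ _ Oux).
Qed.

Lemma mul_odd_even i j :
  x * (u * e i j) = if j then 0 else if i then u * x * e10 else u * x.
Proof. by rewrite [x in LHS]phi1r odd_even_mul // mulmx1 odd_e. Qed.

Lemma mul_odd_e10_even i j :
  x * e10 * (u * e i j) = if j then if i then u * x * e10 else u * x else 0.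
Proof.
rewrite odd_even_mul // mulmx_E eqb_id.
by case: j; [rewrite (odd_e _ _ Oux)|rewrite phi0 amulr0].
Qed.

Lemma mul_odd_odd_e10 : x * (y * e10) = odd_mul B x y * e11.
Proof. by rewrite [x in LHS]phi1r odd_odd_mul // mxconj1 mulmx1 mulmx_E. Qed.

Lemma mul_odd_e10_odd : x * e10 * y = - (odd_mul B x y * e00).
Proof.
rewrite [y in LHS]phi1r odd_odd_mul // mul1mx mxconj_E /= mulmxN mulmx_E /=.
by rewrite phiN amulNr.
Qed.

Lemma mul_odd_e10_odd_e10 : x * e10 * (y * e10) = - (odd_mul B x y * e10).
Proof.
by rewrite odd_odd_mul // mxconj_E /= mulmxN mulmx_E /= mulmxN mulmx_E phiN amulNr.
Qed.

End Products.

Lemma assembleM a b c d x y a' b' c' d' x' y' :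
  centralizer B a -> centralizer B b -> centralizer B c -> centralizer B d ->
  odd_part B x -> odd_part B y ->
  centralizer B a' -> centralizer B b' -> centralizer B c' -> centralizer B d' ->
  odd_part B x' -> odd_part B y' ->
  assemble a b c d x y * assemble a' b' c' d' x' y' =
  assemble (a * a' + b * c' - odd_mul B y x') (a * b' + b * d' + odd_mul B x x')
    (c * a' + d * c' - odd_mul B y y') (c * b' + d * d' + odd_mul B x y')
    (d * x' - b * y' + a' * x + b' * y) (a * y' - c * x' + c' * x + d' * y).
Proof.
move=> Ca Cb Cc Cd Ox Oy Ca' Cb' Cc' Cd' Ox' Oy'.
rewrite {1 2}/assemble !amulDl !amulDr.
repeat match goal with
| Cu : centralizer _ ?u, Cv : centralizer _ ?v |-
    context [?u * e _ _ * (?v * e _ _)] => rewrite (mul_even_even Cu Cv)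
| Cu : centralizer _ ?u, Ov : odd_part _ ?v |- context [?u * e _ _ * ?v] =>
    rewrite (mul_even_odd Cu Ov)
| Cu : centralizer _ ?u, Ov : odd_part _ ?v |-
    context [?u * e _ _ * (?v * e10)] => rewrite (mul_even_odd_e10 Cu Ov)
| Cu : centralizer _ ?u, Ov : odd_part _ ?v |- context [?v * (?u * e _ _)] =>
    rewrite (mul_odd_even Cu Ov)
| Cu : centralizer _ ?u, Ov : odd_part _ ?v |-
    context [?v * e10 * (?u * e _ _)] => rewrite (mul_odd_e10_even Cu Ov)
end.
rewrite (mul_odd_odd_e10 Ox Oy') (mul_odd_e10_odd Oy Ox').
rewrite (mul_odd_e10_odd_e10 Oy Oy') -(odd_mulE Ox Ox').
rewrite /assemble /=. alg A.
Qed.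

Lemma assemble_sixM s t : six_part (gamma_of B) s -> six_part (gamma_of B) t ->
  assemble_six (six_mul (gamma_of B) s t) = assemble_six s * assemble_six t.
Proof.
move: s t => [[[a b] [c d]] [x y]] [[[a' b'] [c' d']] [x' y']].
move=> [[a0 b0 c0 d0] [x0 y0]] [[a0' b0' c0' d0'] [x0' y0']].
rewrite !gamma_partE in a0 b0 c0 d0 x0 y0 a0' b0' c0' d0' x0' y0'.
rewrite /six_mul /assemble_six assembleM; do ?by [apply: gfst_cent|apply: gsnd_odd].
rewrite !gvalE a0 b0 c0 d0 x0 y0 a0' b0' c0' d0' x0' y0' !odd_mul0l.
by rewrite /assemble; alg A.
Qed.

Lemma coordinatize_hom : is_M2_hom (zorn_M2 (gamma_of B)) B coordinatize.
Proof.
split; first split.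
- move=> [[[[a b] [c d]] [x y]] ps] [[[[a' b'] [c' d']] [x' y']] ps'].
  rewrite /coordinatize /= !gvalE /assemble; alg A.
- move=> s [[[[a b] [c d]] [x y]] ps]; rewrite /coordinatize /= !gvalE /assemble.
  by rewrite !ascaleDr !amulZl.
- by move=> [s ps] [t pt]; apply: assemble_sixM.
- rewrite /coordinatize /= !gvalE /assemble !amul1l -e_sum; alg A.
apply/funext=> h; rewrite /coordinatize /= !gvalE /assemble.
by rewrite [in RHS](mx2_span h) !phiD !phiZ !amulZl !amul1l !amul0r !aaddr0.
Qed.

Lemma mx_coord_cent u i j k l : centralizer B u ->
  mx_coord B (u * e k l) i j = if (k == i) && (l == j) then u else 0.
Proof.
move=> Cu; rewrite /mx_coord.
have h p q : e p i * (u * e k l) * e j q = u * (e p i * e k l * e j q).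
  by rewrite -(cent_midA Cu) -Cu !(cent_mulA Cu).
rewrite !h -amulDr !e_mul (eq_sym i k) (eq_sym l j); case: (k == i) => /=.
  rewrite !e_mul eq_sym; case: eqP => _; last by rewrite aadd0 amulr0.
  by rewrite e_sum amul1r.
by rewrite !amul0r aadd0 amulr0.
Qed.

Lemma assemble_eq0 a b c d x y :
  centralizer B a -> centralizer B b -> centralizer B c -> centralizer B d ->
  odd_part B x -> odd_part B y -> assemble a b c d x y = 0 ->
  [/\ a = 0, b = 0, c = 0 & d = 0] /\ x = 0 /\ y = 0.
Proof.
move=> Ca Cb Cc Cd Ox Oy.
have sN := assoc_part_subspace B; have sJ := conj_part_subspace B.
set n := a * e00 + b * e01 + c * e10 + d * e11; set w := x + y * e10.
have Nc u h : centralizer B u -> assoc_part B (u * phi h).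
  move=> Cu; apply: cent_mul_assoc => // k l.
  by apply/(asub_eq0 A); rewrite -!phiM mulmxA.
have Nn : assoc_part B n by do 3?apply: (subspaceD sN); apply: Nc.
have Jw : conj_part B w.
  by apply: (subspaceD sJ); [case: Ox|apply: conj_part_mul; case: Oy].
rewrite /assemble -/n -aaddA -/w => nw.
have w0 : w = 0.
  by apply: conj_part_assoc_eq0 => //; rewrite (aoppP nw); apply: (subspaceN sN).
have n0 : n = 0 by move: nw; rewrite w0 aaddr0.
have co i j : mx_coord B n i j = 0 by rewrite n0 mx_coord0.
split.
  have h i j := co i j; rewrite /n in h.
  move: (h false false) (h false true) (h true false) (h true true).
  rewrite !mx_coordD !mx_coord_cent //= !aaddr0 !aadd0.
  by move=> -> -> -> ->.
have [Jx xe] := Ox; have [Jy ye] := Oy.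
have x0 : x = 0.
  have := congr1 (fun v => v * e00) w0; rewrite /w amulDl xe amul0r.
  by rewrite conj_part_mulA // mulmx_E phi0 amulr0 aaddr0.
split=> //; have := congr1 (fun v => v * e01) w0.
by rewrite /w x0 aadd0 amul0r conj_part_mulA // mulmx_E /= ye.
Qed.

Lemma coordinatize_inj : injective coordinatize.
Proof.
have [hh _] := coordinatize_hom.
move=> s t st; apply/(asub_eq0 (zorn_algebra (gamma_of B))).
have : coordinatize (asub (zorn_algebra (gamma_of B)) s t) = 0.
  by rewrite (homB hh) st; apply: aaddrN.
case: (asub _ s t) => [[[[a b] [c d]] [x y]] p] /=; rewrite /coordinatize /=.
case/assemble_eq0; do ?by [apply: gfst_cent|apply: gsnd_odd].
move=> [a1 b1 c1 d1] [x2 y2]; apply: val_inj_sig => /=.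
case: p => [[a2 b2 c2 d2] [x1 y1]].
rewrite !gamma_partE in a2 b2 c2 d2 x1 y1.
have z p : gfst p = 0 -> gsnd p = 0 -> p = azero (gamma_of B).
  by move=> h1 h2; apply: gpair_inj; rewrite ?h1 ?h2.
by rewrite (z a) // (z b) // (z c) // (z d) // (z x) // (z y).
Qed.

Lemma coordinatize_surj u : exists s, coordinatize s = u.
Proof.
have [n [w [Nn [Jw ->]]]] := assoc_conj_decomp B u.
have [a ea aE] := gfst_surj (mx_coord_centralizer Nn false false).
have [b eb bE] := gfst_surj (mx_coord_centralizer Nn false true).
have [c ec cE] := gfst_surj (mx_coord_centralizer Nn true false).
have [d ed dE] := gfst_surj (mx_coord_centralizer Nn true true).
have Ox : odd_part B (w * e00).
  by split; [apply: conj_part_mul|rewrite conj_part_mulA // mulmx_E].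
have Oy : odd_part B (w * e01).
  by split; [apply: conj_part_mul|rewrite conj_part_mulA // mulmx_E].
have [x ox xE] := gsnd_surj Ox; have [y oy yE] := gsnd_surj Oy.
have p : six_part (gamma_of B) (((a, b), (c, d)), (x, y)) by [].
exists (exist _ _ p); rewrite /coordinatize /= /assemble aE bE cE dE xE yE.
rewrite -(mx_coord_sum Nn) -aaddA; congr (_ + _).
by rewrite conj_part_mulA // mulmx_E /= -amulDr e_sum amul1r.
Qed.

End Coordinatization.

(** * The functor from alternative algebras to Gamma-algebras *)

Section ZornMap.

Variables (F : fieldType) (S T : Type).
Variables (G : gamma_algebra F S) (H : gamma_algebra F T) (g : S -> T).
Hypothesis hg : is_gamma_hom G H g.

Definition six_map (s : six S) : six T :=
  let: (((a, b), (c, d)), (x, y)) := s in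
  (((g a, g b), (g c, g d)), (g x, g y)).

Lemma six_map_part s : six_part G s -> six_part H (six_map s).
Proof.
have [_ gp] := hg.
move: s => [[[a b] [c d]] [x y]] [[? ? ? ?] [? ?]].
by do !split; apply: gp.
Qed.

Definition zorn_map (s : zorn_carrier G) : zorn_carrier H :=
  exist _ _ (six_map_part (proj2_sig s)).

Lemma zorn_map_hom : is_M2_hom (zorn_M2 G) (zorn_M2 H) zorn_map.
Proof.
have [h _] := hg; split; first split.
- move=> [[[[a b] [c d]] [x y]] ps] [[[[a' b'] [c' d']] [x' y']] ps'].
  by apply: val_inj_sig; rewrite /= !(homD h).
- move=> s [[[[a b] [c d]] [x y]] ps].
  by apply: val_inj_sig; rewrite /= !(homZ h).
- move=> [[[[a b] [c d]] [x y]] ps] [[[[a' b'] [c' d']] [x' y']] ps'].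
  by apply: val_inj_sig; rewrite /= !(homD h, homB h, homM h).
- by apply: val_inj_sig; rewrite /= /six_one !(hom1 h, hom0 h).
apply/funext=> k; apply: val_inj_sig.
by rewrite /= /scalar_six !(homZ h, hom1 h, hom0 h).
Qed.

End ZornMap.

Section GammaMap.

Variables (F : fieldType) (S T : Type).
Variables (B : M2_algebra F S) (C : M2_algebra F T).

Section Map.

Variable f : S -> T.
Hypothesis hf : is_M2_hom B C f.

Lemma M2_hom_phi h : f (M2_phi B h) = M2_phi C h.
Proof. by case: hf => _ <-. Qed.

(** The defining conditions only quantify over matrices, so they are preserved
    even when [f] is not surjective. *)
Lemma pair_part_map p : pair_part B p -> pair_part C (f p.1, f p.2).
Proof.
have [h _] := hf; case: p => c x [/= Cc [Jx xe]].
split=> [k|] /=; [|split=> [k|] /=].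
- by rewrite -M2_hom_phi -!(homM h) Cc.
- by rewrite -!M2_hom_phi -!(homM h) Jx.
- by rewrite -M2_hom_phi -(homM h) xe.
Qed.

Definition gamma_map (p : gamma_carrier B) : gamma_carrier C :=
  exist _ _ (pair_part_map (proj2_sig p)).

Lemma gfst_map p : gfst (gamma_map p) = f (gfst p). Proof. by []. Qed.

Lemma gsnd_map p : gsnd (gamma_map p) = f (gsnd p). Proof. by []. Qed.

Lemma hom_odd_mul x y : f (odd_mul B x y) = odd_mul C (f x) (f y).
Proof.
have [h _] := hf.
by rewrite /odd_mul /mx_coord (homD h) !(homM h) !M2_hom_phi.
Qed.

Lemma gamma_map_hom : is_gamma_hom (gamma_of B) (gamma_of C) gamma_map.
Proof.
have [h _] := hf; split; first split.
- by move=> p q; apply: gpair_inj; rewrite gvalE !(gfst_map, gsnd_map) ?gvalE (homD h).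
- by move=> a p; apply: gpair_inj; rewrite gvalE !(gfst_map, gsnd_map) ?gvalE (homZ h).
- move=> p q; apply: gpair_inj; rewrite gvalE !(gfst_map, gsnd_map) ?gvalE.
    by rewrite (homD h) (homM h) hom_odd_mul.
  by rewrite (homD h) !(homM h).
- by apply: gpair_inj; rewrite gvalE !(gfst_map, gsnd_map) ?gvalE ?(hom1 h) ?(hom0 h).
move=> i p; rewrite !gamma_partE gfst_map gsnd_map.
by case: i => ->; rewrite (hom0 h).
Qed.

Lemma coordinatize_nat s :
  f (coordinatize s) = coordinatize (zorn_map gamma_map_hom s).
Proof.
have [h _] := hf; case: s => [[[[a b] [c d]] [x y]] ps].
rewrite /coordinatize /= /assemble !(gfst_map, gsnd_map).
by rewrite !(homD h) !(homM h) !M2_hom_phi.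
Qed.

End Map.

(** Every element is assembled from centralizing elements, odd elements and
    matrices. *)
Lemma gamma_map_faithful f f' (hf : is_M2_hom B C f) (hf' : is_M2_hom B C f') :
  gamma_map hf = gamma_map hf' -> f = f'.
Proof.
move=> e; apply/funext=> u; have [s <-] := coordinatize_surj B u.
rewrite (coordinatize_nat hf) (coordinatize_nat hf'); congr coordinatize.
by apply: val_inj_sig; rewrite /zorn_map /= e.
Qed.

(** [g] acts on the matrices plus columns over the Gamma-algebras, which are the
    algebras themselves by coordinatization. *)
Lemma gamma_map_full g : is_gamma_hom (gamma_of B) (gamma_of C) g ->
  exists f, exists hf : is_M2_hom B C f, gamma_map hf = g.
Proof.
move=> hg.
have [k kK] := choice (coordinatize_surj B).
have Kk : cancel (@coordinatize _ _ B) k by move=> s; apply: coordinatize_inj; rewrite kK.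
pose f := @coordinatize _ _ C \o zorn_map hg \o k.
have [hB pB] := coordinatize_hom B; have [hC pC] := coordinatize_hom C.
have [hM pM] := zorn_map_hom hg.
have hf : is_M2_hom B C f.
  split.
    apply: (hom_comp (hom_comp hC hM)); exact: (hom_inv hB Kk kK).
  apply/funext=> h; rewrite /f /= -pB -pC -pM /=.
  by rewrite Kk.
have fk s : f (coordinatize s) = coordinatize (zorn_map hg s) by rewrite /f /= Kk.
have [gh gp] := hg.
have g0 := hom0 gh.
exists f, hf; apply/funext=> p.
have [p0 ep0 p0E] := gfst_surj (gfst_cent p).
have [p1 op1 p1E] := gsnd_surj (gsnd_odd p).
have gp0 := gp _ _ ep0; have gp1 := gp _ _ op1.
have pE : p = aadd (gamma_of B) p0 p1.
  rewrite !gamma_partE in ep0 op1.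
  by apply: gpair_inj; rewrite gvalE ?p0E ?p1E ?ep0 ?op1 ?aaddr0 ?aadd0.
have f0 : f (gfst p) = gfst (g p0).
  pose o := azero (gamma_of B).
  have part0 : six_part (gamma_of B) (((p0, o), (o, p0)), (o, o)).
    by do !split=> //; apply: (subspace0 (gpart_subspace (gamma_of B) _)).
  have := fk (exist _ _ part0); rewrite /coordinatize /= g0 /assemble !gvalE p0E.
  rewrite !amul0r !aaddr0 -!amulDr !e_sum !amul1r //.
have f1 : f (gsnd p) = gsnd (g p1).
  pose o := azero (gamma_of B).
  have part1 : six_part (gamma_of B) (((o, o), (o, o)), (p1, o)).
    by do !split=> //; apply: (subspace0 (gpart_subspace (gamma_of B) _)).
  have := fk (exist _ _ part1); rewrite /coordinatize /= g0 /assemble !gvalE p1E.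
  by rewrite !amul0r !aaddr0 !aadd0.
rewrite !gamma_partE in gp0 gp1.
by apply: gpair_inj; rewrite ?gfst_map ?gsnd_map ?f0 ?f1 [in RHS]pE (homD gh) gvalE
  ?gp0 ?gp1 ?aaddr0 ?aadd0.
Qed.

End GammaMap.

(** * Recovering a Gamma-algebra from its alternative algebra *)

Section Recover.

Variables (F : fieldType) (T : Type) (G : gamma_algebra F T).

Local Notation A := (gamma_alg G).
Local Notation Z := (zorn_M2 G).
Local Notation "0" := (azero A).
Local Notation "1" := (aone A).
Local Notation "- x" := (aopp A x).
Local Notation "x + y" := (aadd A x y).
Local Notation "x - y" := (asub A x y).
Local Notation "x * y" := (amul A x y).

Definition scalar_part (s : zorn_carrier G) : T := (sval s).1.1.1.
Definition column_part (s : zorn_carrier G) : T := (sval s).2.1.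

Definition unit_six (i j : bool) : six T :=
  ((((if i || j then 0 else 1), (if ~~ i && j then 1 else 0)),
    ((if i && ~~ j then 1 else 0), (if i && j then 1 else 0))), (0, 0)).

Lemma zorn_phi_E i j : sval (M2_phi Z (E F i j)) = unit_six i j.
Proof.
rewrite /= /scalar_six /E /unit_six !mxE.
by case: i; case: j; rewrite /= ?ascale0r ?ascale1.
Qed.

Let simp := (amul0r, amulr0, amul1l, amul1r, aopp0, aadd0, aaddr0).

Lemma cent_zornP (s : zorn_carrier G) : centralizer Z s ->
  sval s = (((scalar_part s, 0), (0, scalar_part s)), (0, 0)).
Proof.
move=> Cs.
have Ce i j : six_mul G (sval s) (unit_six i j) = six_mul G (unit_six i j) (sval s).
  by rewrite -zorn_phi_E; exact: (congr1 (@sval _ _) (Cs (E F i j))).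
have := Ce false false; have := Ce false true.
case: s Cs Ce => [[[[a b] [c d]] [x y]] ps] _ _.
rewrite /scalar_part /six_mul /asub /= !simp.
by move=> [<- <- _ _] [<- -> <-].
Qed.

Lemma odd_zornP (s : zorn_carrier G) : odd_part Z s ->
  sval s = (((0, 0), (0, 0)), (column_part s, 0)).
Proof.
move=> [Js se].
have e1 : six_mul G (sval s) (unit_six false false) = sval s.
  by rewrite -zorn_phi_E; exact: (congr1 (@sval _ _) se).
have e2 : six_mul G (unit_six false false) (sval s) =
    six_mul G (sval s) (unit_six true true).
  rewrite -!zorn_phi_E; have := congr1 (@sval _ _) (Js (E F false false)).
  by rewrite mxconj_E.
have e3 : six_mul G (unit_six false true) (sval s) =
    aopp (six_algebra G) (six_mul G (sval s) (unit_six false true)).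
  have cE : mxconj (E F false true) = (- E F false true)%R by rewrite mxconj_E.
  have h := Js (E F false true); rewrite cE phiN amulNr in h.
  by rewrite -zorn_phi_E; exact: (congr1 (@sval _ _) h).
move: e1 e2 e3.
case: s Js se => [[[[a b] [c d]] [x y]] ps] _ _.
rewrite /column_part /six_mul /asub /= !simp.
by move=> [<- <- <-] [->] [-> _ _].
Qed.

(** The centralizer consists of the scalar matrices with an even entry, the odd
    part of the columns with first entry odd and second entry zero. *)
Definition recover (p : gamma_carrier Z) : T :=
  scalar_part (gfst p) + column_part (gsnd p).

Lemma zorn_part_scalar (s : zorn_carrier G) : gpart G false (scalar_part s).
Proof. by case: s => [[[[a b] [c d]] [x y]] [[? ? ? ?] [? ?]]]. Qed.

Lemma zorn_part_column (s : zorn_carrier G) : gpart G true (column_part s).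
Proof. by case: s => [[[[a b] [c d]] [x y]] [[? ? ? ?] [? ?]]]. Qed.

Lemma recover_hom : is_gamma_hom (gamma_of Z) G recover.
Proof.
have sc s := zorn_part_scalar s; have co s := zorn_part_column s.
split; first split.
- by move=> p q; rewrite /recover !gvalE /scalar_part /column_part /=; alg A.
- by move=> a p; rewrite /recover !gvalE /scalar_part /column_part /= ascaleDr.
- move=> p q; rewrite /recover !gvalE.
  have Cp := gfst_cent p; have Cq := gfst_cent q.
  have Op := gsnd_odd p; have Oq := gsnd_odd q.
  have om : scalar_part (odd_mul Z (gsnd p) (gsnd q)) =
      column_part (gsnd p) * column_part (gsnd q).
    have := congr1 (@sval _ _) (odd_mulE Op Oq).
    set o := odd_mul Z _ _; have Co : centralizer Z o by apply: odd_mul_cent.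
    have -> : sval (amul Z o (M2_phi Z (E F false true))) =
        six_mul G (sval o) (unit_six false true).
      by rewrite -zorn_phi_E.
    have -> : sval (amul Z (gsnd p) (gsnd q)) =
        six_mul G (sval (gsnd p)) (sval (gsnd q)) by [].
    rewrite (odd_zornP Op) (odd_zornP Oq) (cent_zornP Co) /six_mul /asub /= !simp.
    by case.
  have ee : scalar_part (amul Z (gfst p) (gfst q)) =
      scalar_part (gfst p) * scalar_part (gfst q).
    rewrite {1}/scalar_part /= (cent_zornP Cp) (cent_zornP Cq).
    by rewrite /six_mul /asub /= !simp.
  have eo (c x : zorn_carrier G) : centralizer Z c -> odd_part Z x ->
      column_part (amul Z c x) = scalar_part c * column_part x.
    move=> Cc Ox; rewrite {1}/column_part /= (cent_zornP Cc) (odd_zornP Ox).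
    by rewrite /six_mul /asub /= !simp.
  have scD s t : scalar_part (aadd Z s t) = scalar_part s + scalar_part t by [].
  have coD s t : column_part (aadd Z s t) = column_part s + column_part t by [].
  rewrite scD coD ee om !eo // !amulDl !amulDr (gamma_comm (sc (gfst q)) (co (gsnd p))).
  alg A.
- by rewrite /recover !gvalE /scalar_part /column_part /= aaddr0.
have e0 i := subspace0 (gpart_subspace G i).
move=> [] p; rewrite gamma_partE /recover => ->; rewrite /scalar_part /column_part /=.
  by rewrite aadd0; apply: co.
by rewrite aaddr0; apply: sc.
Qed.

Lemma recover_inj : injective recover.
Proof.
have [h _] := recover_hom.
suff h0 r : recover r = 0 -> r = azero (gamma_of Z).
  move=> p q e; apply/(asub_eq0 (gamma_of Z))/h0.
  by rewrite (homB h) e; apply: aaddrN.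
rewrite /recover => r0.
have Cr := gfst_cent r; have Or := gsnd_odd r.
have s0 : scalar_part (gfst r) = 0.
  apply: (@gpart_direct _ _ G); first exact: zorn_part_scalar.
  have -> : scalar_part (gfst r) = - column_part (gsnd r).
    by apply: aoppP; rewrite aaddC.
  by apply: subspaceN; [apply: gpart_subspace|apply: zorn_part_column].
have c0 : column_part (gsnd r) = 0 by rewrite s0 aadd0 in r0.
apply: gpair_inj; apply: val_inj_sig.
  by rewrite (cent_zornP Cr) s0.
by rewrite (odd_zornP Or) c0.
Qed.

Lemma recover_surj t : exists p, recover p = t.
Proof.
have [t0 [t1 [e0 [o1 ->]]]] := gpart_sum G t.
have z i := subspace0 (gpart_subspace G i).
have p0 : six_part G (((t0, 0), (0, t0)), (0, 0)) by do !split.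
have p1 : six_part G (((0, 0), (0, 0)), (t1, 0)) by do !split.
pose s0 : zorn_carrier G := exist _ _ p0; pose s1 : zorn_carrier G := exist _ _ p1.
have h : pair_part Z (s0, s1).
  split=> /=; last split=> /=.
  - apply: centralizer_e => i j; apply: val_inj_sig.
    change (six_mul G (sval s0) (sval (M2_phi Z (E F i j))) =
      six_mul G (sval (M2_phi Z (E F i j))) (sval s0)).
    by rewrite zorn_phi_E; case: i; case: j; rewrite /six_mul /asub /= !simp.
  - apply: conj_part_e => i j; apply: val_inj_sig.
    change (six_mul G (sval (M2_phi Z (E F i j))) (sval s1) =
      six_mul G (sval s1) (sval (M2_phi Z (mxconj (E F i j))))).
    have -> : sval (M2_phi Z (mxconj (E F i j))) =
        if i == j then unit_six (~~ i) (~~ j)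
        else aopp (six_algebra G) (unit_six i j).
      rewrite mxconj_E; case: eqP => [->|_]; first exact: zorn_phi_E.
      by rewrite phiN -zorn_phi_E.
    by rewrite zorn_phi_E; case: i; case: j; rewrite /six_mul /asub /= ?amulNr ?amulNl !simp.
  - apply: val_inj_sig.
    change (six_mul G (sval s1) (sval (M2_phi Z (E F false false))) = sval s1).
    by rewrite zorn_phi_E /six_mul /asub /= !simp.
by exists (exist _ _ h).
Qed.

End Recover.

Local Open Scope classical_set_scope.

(** * Cardinal arithmetic *)


Lemma injective_surjective_bijective (S T : Type) (f : S -> T) :
  injective f -> (forall y, exists x, f x = y) -> bijective f.
Proof.
move=> fI fS; have [g gK] := choice fS.
by exists g => // x; apply: fI; rewrite gK.
Qed.

(** The bijection agrees at each point with [f] or with the inverse of [g];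
    this is what later keeps it inside a given relation. *)
Lemma schroeder_bernstein (S T : Type) (f : S -> T) (g : T -> S) :
  injective f -> injective g ->
  exists2 h : S -> T, bijective h & forall x, h x = f x \/ g (h x) = x.
Proof.
move=> fI gI.
(* the points whose chain of preimages under [g \o f] ends outside the range of [g] *)
pose C x := exists n z, (forall y, g y <> z) /\ iter n (g \o f) z = x.
have NC x : ~ C x -> exists y, g y = x.
  move=> nC; apply: contrapT => ng; apply: nC; exists 0%N, x; split=> // y gy.
  by apply: ng; exists y.
have hP x : exists y, (C x -> y = f x) /\ (~ C x -> g y = x).
  have [Cx|nCx] := pselect (C x); first by exists (f x).
  by have [y gy] := NC _ nCx; exists y.
have [h {}hP] := choice hP.
exists h; last first.
  by move=> x; have [/(proj1 (hP x))|/(proj2 (hP x))] := pselect (C x); [left|right].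
have CS x : C x -> C (g (f x)) by move=> [n [z [nz <-]]]; exists n.+1, z.
apply: injective_surjective_bijective => [x x' e|y].
  have [Cx|nCx] := pselect (C x); have [Cx'|nCx'] := pselect (C x').
  - by apply: fI; rewrite -(proj1 (hP x) Cx) -(proj1 (hP x') Cx').
  - exfalso; apply: (nCx'); rewrite -(proj2 (hP x') nCx') -e (proj1 (hP x) Cx).
    exact: CS.
  - exfalso; apply: (nCx); rewrite -(proj2 (hP x) nCx) e (proj1 (hP x') Cx').
    exact: CS.
  - by rewrite -(proj2 (hP x) nCx) -(proj2 (hP x') nCx') e.
have [Cy|nCy] := pselect (C (g y)); last first.
  by exists (g y); apply: gI; apply: (proj2 (hP (g y))).
case: Cy => -[|n] [z [nz /= e]]; first by case: (nz y).
exists (iter n (g \o f) z); rewrite (proj1 (hP _)); last by exists n, z.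
exact: gI.
Qed.

Lemma injection_comparable (S T : Type) :
  (exists f : S -> T, injective f) \/ (exists f : T -> S, injective f).
Proof.
pose P (G : set (S * T)) :=
  (forall x y y', G (x, y) -> G (x, y') -> y = y') /\
  (forall x x' y, G (x, y) -> G (x', y) -> x = x').
have [|G [[Gf Gi] Gmax]] := @Zorn_bigcup _ P.
  move=> C CP Ctot.
  have two p q : (\bigcup_(X in C) X) p -> (\bigcup_(X in C) X) q ->
      exists X, [/\ C X, X p & X q].
    move=> [X CX Xp] [Y CY Yq]; have [XY|YX] := Ctot _ _ CX CY.
      by exists Y; split=> //; apply: XY.
    by exists X; split=> //; apply: YX.
  split=> [x y y' h h'|x x' y h h']; have [X [CX a b]] := two _ _ h h'.
    exact: (proj1 (CP _ CX)) a b.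
  exact: (proj2 (CP _ CX)) a b.
have [dom|/existsNP[x0 nx0]] := pselect (forall x, exists y, G (x, y)).
  left; have [f fP] := choice dom; exists f => x x' e.
  by apply: (Gi _ _ (f x)); rewrite // e.
have [ran|/existsNP[y0 ny0]] := pselect (forall y, exists x, G (x, y)).
  right; have [f fP] := choice ran; exists f => y y' e.
  by apply: (Gf (f y)); rewrite // e.
exfalso; apply: (Gmax (G `|` [set (x0, y0)])).
  split; first by move=> p; left.
  by move=> /(_ (x0, y0) (or_intror erefl)) h; apply: nx0; exists y0.
split=> [x y y'|x x' y] [h|[-> ->]] [h'|].
- exact: Gf h h'.
- by move=> [? ?]; subst; case: nx0; exists y.
- by case: nx0; exists y'.
- by move=> [].
- exact: Gi h h'.
- by move=> [? ?]; subst; case: ny0; exists x.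
- by case: ny0; exists x'.
- by move=> [].
Qed.

Section Square.

Variable T : Type.
Hypothesis infT : infinite_set [set: T].

Lemma infinite_nat_inj : exists i : nat -> T, injective i.
Proof.
move/infiniteP: infT; case/card_leP=> f.
pose n0 (n : nat) : [set: nat] := exist _ n (mem_setT n).
exists (fun n => val (f (n0 n))) => m n /val_inj e.
have := 'inj_f (mem_setT (n0 m)) (mem_setT (n0 n)) e.
by move=> [].
Qed.

Definition square_dom (G : set ((T * T) * T)) (x : T) : Prop := exists z, G ((x, x), z).

(** [G] is the graph of an injection of [D * D] into [D], for [D] its domain. *)
Record square_graph (G : set ((T * T) * T)) : Prop := SquareGraph {
  sg_total : forall x y, square_dom G x -> square_dom G y -> exists z, G ((x, y), z);
  sg_closed : forall x y z, G ((x, y), z) ->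
    [/\ square_dom G x, square_dom G y & square_dom G z];
  sg_fun : forall p z z', G (p, z) -> G (p, z') -> z = z';
  sg_inj : forall p p' z, G (p, z) -> G (p', z) -> p = p'
}.

Lemma square_graph_bigcup (C : set (set ((T * T) * T))) :
  C `<=` square_graph -> total_on C subset -> square_graph (\bigcup_(X in C) X).
Proof.
move=> CP Ctot.
have two p q : (\bigcup_(X in C) X) p -> (\bigcup_(X in C) X) q ->
    exists X, [/\ C X, X p & X q].
  move=> [X CX Xp] [Y CY Yq]; have [XY|YX] := Ctot _ _ CX CY.
    by exists Y; split=> //; apply: XY.
  by exists X; split=> //; apply: YX.
have up X x : C X -> square_dom X x -> square_dom (\bigcup_(X in C) X) x.
  by move=> CX [z Xz]; exists z, X.
split=> [x y [z h] [z' h']|x y z [X CX Xz]|p z z' h h'|p p' z h h'].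
- have [X [CX Xx Xy]] := two _ _ h h'.
  have [z0 Xz0] := sg_total (CP _ CX) (ex_intro _ z Xx) (ex_intro _ z' Xy).
  by exists z0, X.
- by have [? ? ?] := sg_closed (CP _ CX) Xz; split; apply: up CX _.
- by have [X [CX a b]] := two _ _ h h'; apply: (sg_fun (CP _ CX) a b).
- by have [X [CX a b]] := two _ _ h h'; apply: (sg_inj (CP _ CX) a b).
Qed.

Lemma square_graph_maximal : exists G, [/\ square_graph G,
  (forall H, square_graph H -> G `<=` H -> H `<=` G) &
  exists d0 d1, [/\ square_dom G d0, square_dom G d1 & d0 <> d1]].
Proof.
have [i iI] := infinite_nat_inj.
pose G0 : set ((T * T) * T) :=
  [set t | exists m n, t = ((i m, i n), i (pickle (m, n)))].
have pI m n m' n' : i (pickle (m, n)) = i (pickle (m', n')) -> m = m' /\ n = n'.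
  by move=> /iI /(pcan_inj pickleK) [].
have G0dom n : square_dom G0 (i n) by exists (i (pickle (n, n))), n, n.
have G0P : square_graph G0.
  split.
  - by move=> x y [z [m [m' [-> _ _]]]] [z' [n [n' [-> _ _]]]];
      exists (i (pickle (m, n))), m, n.
  - by move=> x y z [m [n [-> -> ->]]]; split.
  - by move=> p z z' [m [n [-> ->]]] [m' [n' [/iI-> /iI-> ->]]].
  - by move=> p p' z [m [n [-> ->]]] [m' [n' [-> /pI[-> ->]]]].
pose P G := square_graph G /\ (G !=set0 -> G0 `<=` G).
have [|G [[GP G0G] Gmax]] := @Zorn_bigcup _ P.
  move=> C CP Ctot; split.
    by apply: square_graph_bigcup => // X /CP [].
  move=> [p [X CX Xp]] q G0q; exists X => //.
  by apply: (proj2 (CP _ CX)) => //; exists p.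
have Gn0 : G !=set0.
  apply: contrapT => G_0; apply: (Gmax G0); last by split=> // _ p.
  split; first by move=> p Gp; case: G_0; exists p.
  move=> /(_ ((i 0, i 0), i (pickle (0, 0)))%N) h; apply: G_0.
  by eexists; apply: h; exists 0%N, 0%N.
have {}G0G := G0G Gn0.
exists G; split=> //.
  move=> H HP GH; apply: contrapT => nHG; apply: (Gmax H); split=> // _.
  by move=> p /G0G/GH.
have up n : square_dom G (i n) by have [z /G0G Gz] := G0dom n; exists z.
by exists (i 0%N), (i 1%N); split=> // /iI.
Qed.

(** For [D] the domain of a maximal graph, compare [D] with its complement [D'].
    If [D'] embeds into [D], then so does the whole type, since two copies of [D]
    embed into [D * D] by means of [d0] and [d1]; squares then follow.  If [D] embeds into [D'],
    the graph extends to [D] plus the image of [D]: the new pairs, tagged by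
    [d0] and [d1] according to the side of their entries, are sent to the image. *)
Lemma square_injection : exists f : T * T -> T, injective f.
Proof.
have [G [GP Gmax [d0 [d1 [D0 D1 d01]]]]] := square_graph_maximal.
pose D := square_dom G.
have [j jP] : exists j : T * T -> T, forall x y, D x -> D y -> G ((x, y), j (x, y)).
  have /choice[j jP] p : exists z, D p.1 -> D p.2 -> G (p, z).
    have [[D1' D2]|n] := pselect (D p.1 /\ D p.2).
      by have [z] := sg_total GP D1' D2; rewrite -surjective_pairing; exists z.
    by exists d0 => a b; case: n.
  by exists j => x y; apply: (jP (x, y)).
have jD x y : D x -> D y -> D (j (x, y)).
  by move=> Dx Dy; have [] := sg_closed GP (jP _ _ Dx Dy).
have jI x y x' y' : D x -> D y -> D x' -> D y' ->
    j (x, y) = j (x', y') -> x = x' /\ y = y'.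
  move=> Dx Dy Dx' Dy' e; have h := jP _ _ Dx Dy; rewrite e in h.
  by have [] := sg_inj GP h (jP _ _ Dx' Dy').
have [[h hI]|[k kI]] := injection_comparable {x | D x} {x | ~ D x}; last first.
  pose c x := if pselect (D x) is right nDx then j (sval (k (exist _ x nDx)), d1)
    else j (x, d0).
  have cD x : D (c x).
    rewrite /c; case: pselect => [Dx|nDx]; apply: jD => //.
    by case: (k _).
  have cI : injective c.
    move=> x y; rewrite /c; case: pselect => [Dx|nDx]; case: pselect => [Dy|nDy].
    - by move=> /jI [].
    - move=> /jI [] //; first by case: (k _).
    - move=> /jI [] //; first by case: (k _).
      by move=> _ /esym.
    - move=> /jI [] //; [by case: (k _)|by case: (k _)|].
      by move=> /val_inj_sig /kI [].
  exists (fun p => j (c p.1, c p.2)) => -[x y] [x' y'] /= /jI [] //.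
  by move=> /cI -> /cI ->.
have [g [gD gI]] : exists g : T -> T, (forall u, D u -> ~ D (g u)) /\
    (forall u v, D u -> D v -> g u = g v -> u = v).
  exists (fun u => if pselect (D u) is left Du then sval (h (exist _ u Du)) else u).
  split=> [u Du|u v Du Dv].
    by case: pselect => // Du'; case: (h _).
  case: pselect => // Du'; case: pselect => // Dv' /val_inj_sig /hI [].
  by [].
pose rep x u b := (D x /\ u = x /\ b = d0) \/ (D u /\ x = g u /\ b = d1).
have repD x u b : rep x u b -> D u /\ D b.
  by move=> [[? [-> ->]]|[? [_ ->]]].
have rep_fun x u b u' b' : rep x u b -> rep x u' b' -> u = u' /\ b = b'.
  move=> [[Dx [-> ->]]|[Du [xE ->]]] [[Dx' [-> ->]]|[Du' [xE' ->]]] //.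
  - by case: (gD _ Du'); rewrite -xE'.
  - by case: (gD _ Du); rewrite -xE.
  - by split=> //; apply: gI; rewrite // -xE -xE'.
have rep_inj x x' u b : rep x u b -> rep x' u b -> x = x'.
  move=> [[Dx [-> ->]]|[Du [-> ->]]] [[Dx' [-> e]]|[Du' [-> e]]] //.
  by case: d01.
pose code u b v c := j (j (u, v), j (b, c)).
pose H : set ((T * T) * T) := [set t | G t \/
  exists u b v c, [/\ rep t.1.1 u b, rep t.1.2 v c, ~ (D t.1.1 /\ D t.1.2) &
    t.2 = g (code u b v c)]].
have code_D x y u b v c : rep x u b -> rep y v c -> D (code u b v c).
  by move=> /repD[? ?] /repD[? ?]; do 2?apply: (jD); do ?apply: (jD).
have domP x : (exists u b, rep x u b) <-> square_dom H x.
  split=> [[u [b r]]|[z [/(sg_closed GP) [Dx _ _]|[u [b [v [c [r _ _ _]]]]]]]].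
  - have [[z Gz]|nDx] := pselect (D x); first by exists z; left.
    exists (g (code u b u b)); right; exists u, b, u, b; split=> //.
    by case.
  - by exists x, d0; left.
  - by exists u, b.
have HP : square_graph H.
  split.
  - move=> x y /domP[u [b r]] /domP[v [c r']].
    have [[Dx Dy]|n] := pselect (D x /\ D y).
      by have [z Gz] := sg_total GP Dx Dy; exists z; left.
    by exists (g (code u b v c)); right; exists u, b, v, c.
  - move=> x y z [/(sg_closed GP) [Dx Dy Dz]|[u [b [v [c [r r' _ /= ->]]]]]].
      by split; apply/domP; [exists x, d0|exists y, d0|exists z, d0]; left.
    split; apply/domP; [by exists u, b|by exists v, c|].
    by exists (code u b v c), d1; right; split=> //; apply: code_D r r'.
  - move=> [x y] z z' [Gz|[u [b [v [c [r r' n /= ->]]]]]]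
      [Gz'|[u' [b' [v' [c' [s s' n' /= ->]]]]]].
    + exact: (sg_fun GP Gz Gz').
    + by case: n'; have [] := sg_closed GP Gz.
    + by case: n; have [] := sg_closed GP Gz'.
    + by have [-> ->] := rep_fun _ _ _ _ _ r s; have [-> ->] := rep_fun _ _ _ _ _ r' s'.
  - move=> [x y] [x' y'] z [Gz|[u [b [v [c [r r' n /= zE]]]]]]
      [Gz'|[u' [b' [v' [c' [s s' n' /= zE']]]]]].
    + exact: (sg_inj GP Gz Gz').
    + have [_ _] := sg_closed GP Gz; rewrite zE' => Dz.
      by case: (gD _ (code_D _ _ _ _ _ _ s s')).
    + have [_ _] := sg_closed GP Gz'; rewrite zE => Dz.
      by case: (gD _ (code_D _ _ _ _ _ _ r r')).
    + have Dc := code_D _ _ _ _ _ _ r r'; have Dc' := code_D _ _ _ _ _ _ s s'.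
      have e : code u b v c = code u' b' v' c' by apply: gI; rewrite // -zE -zE'.
      have [[? ?] [? ?]] := (repD _ _ _ r, repD _ _ _ r').
      have [[? ?] [? ?]] := (repD _ _ _ s, repD _ _ _ s').
      have [e1 e2] : j (u, v) = j (u', v') /\ j (b, c) = j (b', c').
        by apply: jI e; apply: jD.
      have [? ?] : u = u' /\ v = v' by apply: jI e1.
      have [? ?] : b = b' /\ c = c' by apply: jI e2.
      subst; have /= -> := rep_inj _ _ _ _ r s.
      by have /= -> := rep_inj _ _ _ _ r' s'.
exfalso; apply: (gD _ D0).
have : H ((g d0, g d0), g (code d0 d1 d0 d1)).
  right; exists d0, d1, d0, d1; split=> //=; try by right.
  by move=> [Dg _]; apply: (gD _ D0).
have GH : G `<=` H by move=> p; left.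
by move=> /(Gmax _ HP GH) /(sg_closed GP) [].
Qed.

End Square.

Lemma injective_finite (S T : Type) (f : S -> T) :
  injective f -> finite_set [set: T] -> finite_set [set: S].
Proof.
by move=> fI fT; rewrite -(preimage_setT f); apply: finite_preimage => // ? ? _ _ /fI.
Qed.

Lemma square_finite (T : Type) : finite_set [set: T] -> finite_set [set: T * T].
Proof. by move=> fT; rewrite -setXTT; apply: finite_setX. Qed.

Lemma finite_nat_inj (T : Type) : finite_set [set: T] ->
  exists n (f : T -> nat), injective f /\ forall x, (f x < n)%N.
Proof.
case/finite_set_leP=> n /pcard_leP[f]; exists n, f; split=> [x y|x].
  by apply: 'inj_f; apply: mem_setT.
by have := 'funS_f (x := x) I.
Qed.

(** * Naming the elements of an isomorphism class *)

Section Encoding.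

Variable U : Type.
Hypothesis infU : infinite_set [set: U].

(** A function is coded by the range of an injective one: pairing the names of
    the elements of [Y] with the values makes the range a graph.  It remains to
    code functions on [X] by functions on [Y]: on a finite [X] they are tuples,
    which single elements of [U] can code, and otherwise they are composed with
    a surjection from [Y]. *)
Lemma fun_encoding (X Y : Type) (iY : Y -> U) (y0 : Y) : injective iY ->
  finite_set [set: X] \/ (exists b : Y -> X, forall x, exists y, b y = x) ->
  exists k : (X -> U) -> (Y -> U), (forall e, injective (k e)) /\
    (forall e e', range (k e) = range (k e') -> e = e').
Proof.
have [j jI] := square_injection infU; move=> iYI h.
suff [f fI] : exists f : (X -> U) -> (Y -> U), injective f.
  exists (fun e y => j (iY y, f e y)); split=> [e y y' /jI [/iYI]//|e e' r].
  apply: fI; apply/funext=> y.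
  have : range (fun y => j (iY y, f e' y)) (j (iY y, f e y)) by rewrite -r; exists y.
  by move=> [y' _ /jI [/iYI ->]].
case: h => [/finite_nat_inj[n [c [cI cn]]]|[b bS]]; last first.
  exists (fun e y => e (b y)) => e e' ee; apply/funext=> x.
  by have [y <-] := bS x; exact: (congr1 (fun f => f y) ee).
pose u0 := iY y0.
have [d dP] : exists d : (X -> U) -> nat -> U, forall e x, d e (c x) = e x.
  exists (fun e i => if pselect (exists x, c x = i) is left h
                     then e (projT1 (cid h)) else u0).
  move=> e x; case: pselect => [h|[]]; last by exists x.
  by case: (cid h) => /= x' /cI ->.
pose fix code (n : nat) (g : nat -> U) {struct n} : U :=
  if n is n'.+1 then j (g n', code n' g) else u0.
have codeI g g' m : code m g = code m g' -> forall i, (i < m)%N -> g i = g' i.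
  elim: m => [//|m IH] /= /jI [e1 /IH e2] i.
  by rewrite ltnS leq_eqVlt => /orP[/eqP->//|/e2].
exists (fun e _ => code n (d e)) => e e' /(congr1 (fun f => f y0)) /codeI ee.
by apply/funext=> x; rewrite -dP ee // dP.
Qed.

(** Two families of structures [P] and [Q] carried by types, with a
    correspondence [R] between isomorphism classes.  [embP p e p'] says that the
    injection [e] of the carrier of [p] transports [p] to [p'].  In each class
    fix representatives [p0], [q0]; a structure [p] of the class is given by an
    embedding of [p0], which is coded by a subset of [U] that is
    the carrier of a copy of [q0]. *)
Lemma object_injection (P Q : Type) (XP : P -> Type) (XQ : Q -> Type)
  (iQ : forall q, XQ q -> U) (y0 : forall q, XQ q) (SQ : Q -> set U)
  (embP : forall p, (XP p -> U) -> P -> Prop)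
  (embQ : forall q, (XQ q -> U) -> Q -> Prop) (R : P -> Q -> Prop) :
  (forall q, injective (iQ q)) ->
  (forall p, exists q, R p q) ->
  (forall p p' q q', R p q -> R p' q -> R p' q' -> R p q') ->
  (forall p p' q, R p q -> R p' q -> exists e, embP p e p') ->
  (forall p q e q', R p q -> embQ q e q' -> R p q') ->
  (forall p e p' p'', embP p e p' -> embP p e p'' -> p' = p'') ->
  (forall q e, injective e -> exists q', embQ q e q' /\ SQ q' = range e) ->
  (forall p q, R p q ->
     finite_set [set: XP p] \/ exists b : XQ q -> XP p, forall x, exists y, b y = x) ->
  exists i : P -> Q, injective i /\ forall p, R p (i p).
Proof.
move=> iQI ex dif isoP isoQ uniP exQ card.
(* The representatives only depend on the predicate [R p], that is, on the class
   of [p]. *)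
have /choice[c cP] (S : {S | exists p, R p = S}) :
    exists t : P * Q, R t.1 = sval S /\ R t.1 t.2.
  by case: (proj2_sig S) => p pS; have [q Rpq] := ex p; exists (p, q).
pose data p := c (exist _ (R p) (ex_intro _ p erefl)).
have dataP p : R (data p).1 = R p /\ R (data p).1 (data p).2 by apply: cP.
pose D := {t : P * Q | R t.1 t.2}.
have code (t : D) : {k : (XP (sval t).1 -> U) -> Q |
    (forall e, exists e', embQ (sval t).2 e' (k e)) /\
    (forall e e', k e = k e' -> e = e')}.
  case: t => -[p q] /= Rpq; apply: cid.
  have [k [kI kR]] := fun_encoding (y0 q) (iQI q) (card _ _ Rpq).
  have [f fP] := choice (fun e => exQ q (k e) (kI e)).
  exists f; split=> [e|e e' fe]; first by exists (k e); case: (fP e).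
  by apply: kR; rewrite -(proj2 (fP e)) -(proj2 (fP e')) fe.
pose dat p : D := exist _ (data p) (proj2 (dataP p)).
have eP p : {e | embP (sval (dat p)).1 e p}.
  apply: cid; have [e Re] := dataP p; apply: isoP Re _.
  by rewrite -e; case: (dataP p).
exists (fun p => sval (code (dat p)) (sval (eP p))).
have R_i p : R p (sval (code (dat p)) (sval (eP p))).
  case: (code (dat p)) => /= k [kQ _]; have [e' em] := kQ (sval (eP p)).
  have [<- Rd] := dataP p; exact: isoQ Rd em.
split=> // p p' ii.
have RR : R p = R p'.
  have r := R_i p; have r' := R_i p'; rewrite -ii in r'.
  by apply/funext=> q; apply/propext; split=> h; [apply: dif r' r h|apply: dif r r' h].
have dd : dat p = dat p'.
  apply: eq_exist; rewrite /data; congr c; exact: eq_exist.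
have gen (t t' : D) e e' : t = t' -> embP (sval t).1 e p ->
    embP (sval t').1 e' p' ->
    sval (code t) e = sval (code t') e' -> p = p'.
  move=> tt'; move: e e'; rewrite -{}tt' => e e' h h'.
  case: (code t) => /= k [_ kI] /kI ee; rewrite ee in h; exact: uniP h h'.
exact: gen dd (proj2_sig (eP p)) (proj2_sig (eP p')) ii.
Qed.

End Encoding.

(** * Isomorphisms *)

Lemma gamma_hom_inv (F : fieldType) (S T : Type) (G : gamma_algebra F S)
    (H : gamma_algebra F T) f g :
  is_gamma_hom G H f -> cancel f g -> cancel g f -> is_gamma_hom H G g.
Proof.
move=> [hf pf] fK gK; split; first exact: (hom_inv hf fK gK).
move=> i x Hx; have [y0 [y1 [G0 [G1 e]]]] := gpart_sum G (g x).
have xE : x = aadd H (f y0) (f y1) by rewrite -(homD hf) -e gK.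
have sH i := gpart_subspace H i.
have z y : f y = azero H -> y = azero G.
  by move=> fy; apply: (can_inj fK); rewrite fy (hom0 hf).
case: i Hx => Hx; rewrite e.
  suff -> : y0 = azero G by rewrite aadd0.
  apply: z; apply: (@gpart_direct _ _ H); first exact: pf.
  have -> : f y0 = asub H x (f y1) by rewrite xE; alg (gamma_alg H).
  by apply: (subspaceD (sH _)) => //; apply: (subspaceN (sH _)); apply: pf.
suff -> : y1 = azero G by rewrite aaddr0.
apply: z; apply: (@gpart_direct _ _ H); last exact: pf.
have -> : f y1 = asub H x (f y0) by rewrite xE; alg (gamma_alg H).
by apply: (subspaceD (sH _)) => //; apply: (subspaceN (sH _)); apply: pf.
Qed.

Lemma gamma_hom_comp (F : fieldType) (S T U : Type) (G : gamma_algebra F S)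
    (H : gamma_algebra F T) (K : gamma_algebra F U) g f :
  is_gamma_hom H K g -> is_gamma_hom G H f -> is_gamma_hom G K (g \o f).
Proof.
by move=> [hg pg] [hf pf]; split; [apply: hom_comp hg hf|move=> i x /pf /pg].
Qed.

Lemma M2_hom_inv (F : fieldType) (S T : Type) (B : M2_algebra F S)
    (C : M2_algebra F T) f g :
  is_M2_hom B C f -> cancel f g -> cancel g f -> is_M2_hom C B g.
Proof.
move=> [hf pf] fK gK; split; first exact: (hom_inv hf fK gK).
by rewrite -pf; apply/funext=> h /=; rewrite fK.
Qed.

Lemma M2_hom_comp (F : fieldType) (S T U : Type) (A : M2_algebra F S)
    (B : M2_algebra F T) (C : M2_algebra F U) g f :
  is_M2_hom B C g -> is_M2_hom A B f -> is_M2_hom A C (g \o f).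
Proof.
move=> [hg pg] [hf pf]; split; first exact: hom_comp hg hf.
by rewrite -pg -pf.
Qed.

Definition gamma_isomorphic (F : fieldType) (S T : Type) (G : gamma_algebra F S)
  (H : gamma_algebra F T) : Prop := exists2 f, is_gamma_hom G H f & bijective f.

Lemma gamma_isomorphic_sym (F : fieldType) (S T : Type) (G : gamma_algebra F S)
    (H : gamma_algebra F T) : gamma_isomorphic G H -> gamma_isomorphic H G.
Proof.
move=> [f hf [g fK gK]]; exists g; first exact: gamma_hom_inv hf fK gK.
by exists f.
Qed.

Lemma gamma_isomorphic_trans (F : fieldType) (S T U : Type)
    (G : gamma_algebra F S) (H : gamma_algebra F T) (K : gamma_algebra F U) :
  gamma_isomorphic G H -> gamma_isomorphic H K -> gamma_isomorphic G K.
Proof.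
move=> [f hf bf] [g hg bg]; exists (g \o f); first exact: gamma_hom_comp hg hf.
exact: bij_comp.
Qed.

Lemma recover_isomorphic (F : fieldType) (T : Type) (G : gamma_algebra F T) :
  gamma_isomorphic (gamma_of (zorn_M2 G)) G.
Proof.
exists (@recover _ _ G); first exact: recover_hom.
apply: injective_surjective_bijective; first exact: recover_inj.
exact: recover_surj.
Qed.

Lemma coordinatize_bij (F : fieldType) (T : Type) (B : M2_algebra F T) :
  bijective (@coordinatize _ _ B).
Proof.
apply: injective_surjective_bijective; first exact: coordinatize_inj.
exact: coordinatize_surj.
Qed.

(** Fullness lifts an isomorphism and its inverse, faithfulness makes the lifts
    inverse to each other. *)
Lemma gamma_of_reflects (F : fieldType) (S T : Type) (B : M2_algebra F S)
    (C : M2_algebra F T) : gamma_isomorphic (gamma_of B) (gamma_of C) ->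
  exists2 f, is_M2_hom B C f & bijective f.
Proof.
move=> [g hg [g' gK g'K]]; have hg' := gamma_hom_inv hg gK g'K.
have [f [hf fE]] := gamma_map_full hg; have [f' [hf' fE']] := gamma_map_full hg'.
have id1 : is_M2_hom B B id by []. have id2 : is_M2_hom C C id by [].
exists f => //; exists f' => x.
  have := @gamma_map_faithful _ _ _ _ _ _ _ (M2_hom_comp hf' hf) id1.
  move=> h; have {}h := h _; rewrite -[LHS]/((f' \o f) x) h //.
  apply/funext=> p; have := gK p; rewrite -fE -fE' => e.
  by apply: gpair_inj;
    [exact: (congr1 (@gfst _ _ _) e)|exact: (congr1 (@gsnd _ _ _) e)].
have := @gamma_map_faithful _ _ _ _ _ _ _ (M2_hom_comp hf hf') id2.
move=> h; rewrite -[LHS]/((f \o f') x) h //.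
apply/funext=> p; have := g'K p; rewrite -fE -fE' => e.
by apply: gpair_inj;
    [exact: (congr1 (@gfst _ _ _) e)|exact: (congr1 (@gsnd _ _ _) e)].
Qed.


(** * Categories *)

(* From here on [hom] and [comp] are those of categories. *)
Import Defs.

Lemma equivalence_of_ff_eso (C D : category) (K : functor C D)
    (p : ob D -> ob C)
    (eta : forall Y, hom (K (p Y)) Y) (theta : forall Y, hom Y (K (p Y))) :
  (forall X Y, bijective (@fmap C D K X Y)) ->
  (forall Y, comp (theta Y) (eta Y) = idm _) ->
  (forall Y, comp (eta Y) (theta Y) = idm _) ->
  equivalent_categories C D.
Proof.
move=> ff te et.
have kP X Y : {k : hom (K X) (K Y) -> hom X Y | cancel k (@fmap C D K X Y) }.
  by apply: cid; case: (ff X Y) => k _ h; exists k.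
pose k X Y := sval (kP X Y).
have kK X Y g : fmap K (k X Y g) = g := proj2_sig (kP X Y) g.
have inj X Y : injective (@fmap C D K X Y) by apply: bij_inj.
pose l X Y (g : hom X Y) : hom (p X) (p Y) := k _ _ (comp (theta Y) (comp g (eta X))).
have l1 X : l X X (idm X) = idm (p X).
  by apply: inj; rewrite kK comp1m te fmap1.
have lM X Y Z (g : hom Y Z) (f : hom X Y) :
    l _ _ (comp g f) = comp (l _ _ g) (l _ _ f).
  by apply: inj; rewrite fmapM !kK -!compA (compA (eta Y)) et comp1m.
pose L : functor D C := @Functor D C p l l1 lM.
exists K, L; split.
  exists (fun X => k _ _ (eta (K X))), (fun X => k _ _ (theta (K X))).
  split; [|split] => [X|X|X Y f]; apply: inj; rewrite /= !fmapM ?fmap1 !kK //.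
  by rewrite compA et comp1m.
exists eta, theta; split=> //; split=> // X Y f.
by rewrite /= kK compA et comp1m.
Qed.

(** A choice of copies [o X] of the Gamma-algebras [gamma_of X] determines a
    functor with [o] as its action on objects; being conjugate to [gamma_map] it is
    fully faithful for every choice. *)
Section GammaFunctor.

Variables (F : fieldType) (I J : Type) (El : I -> Type) (El' : J -> Type).

Local Notation C := (M2_category F El).
Local Notation D := (gamma_category F El').

Variable o : ob C -> ob D.
Hypothesis oP : forall X : M2_object F El,
  gamma_isomorphic (gamma_of X) (gamma_str (o X)).

Let isoP (X : M2_object F El) :
  {t : (gamma_carrier X -> El' (gamma_index (o X))) *
       (El' (gamma_index (o X)) -> gamma_carrier X) |
    [/\ is_gamma_hom (gamma_of X) (gamma_str (o X)) t.1,
        cancel t.1 t.2 & cancel t.2 t.1]}.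
Proof. by apply: cid; case: (oP X) => f hf [g fK gK]; exists (f, g). Qed.

Let t X := (sval (isoP X)).1.
Let u X := (sval (isoP X)).2.

Let t_hom (X : M2_object F El) : is_gamma_hom (gamma_of X) (gamma_str (o X)) (@t X).
Proof. by rewrite /t; case: (isoP X) => ? []. Qed.

Let tK (X : M2_object F El) : cancel (@t X) (@u X).
Proof. by rewrite /t /u; case: (isoP X) => ? []. Qed.

Let uK (X : M2_object F El) : cancel (@u X) (@t X).
Proof. by rewrite /t /u; case: (isoP X) => ? []. Qed.

Let u_hom (X : M2_object F El) : is_gamma_hom (gamma_str (o X)) (gamma_of X) (@u X).
Proof. exact: gamma_hom_inv (t_hom X) (@tK X) (@uK X). Qed.

Definition gamma_fmap (X Y : ob C) (f : hom X Y) : hom (o X) (o Y) :=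
  exist _ (@t Y \o gamma_map (proj2_sig f) \o @u X)
    (gamma_hom_comp (gamma_hom_comp (t_hom Y) (gamma_map_hom (proj2_sig f)))
      (u_hom X)).

Definition gamma_functor : functor C D.
Proof.
refine (@Functor C D o gamma_fmap _ _) => [X|X Y Z g f];
  apply: eq_exist; apply/funext=> x /=.
  rewrite -[RHS]uK; congr (@t X _); exact: gpair_inj.
congr (@t Z _); rewrite tK; exact: gpair_inj.
Defined.

Lemma gamma_functor_ff X Y : bijective (@fmap C D gamma_functor X Y).
Proof.
apply: injective_surjective_bijective =>
  [[f hf] [f' hf'] /(congr1 (@sval _ _)) /= e|[g hg]].
  apply: eq_exist; suff /gamma_map_faithful : gamma_map hf = gamma_map hf' by [].
  apply/funext=> p.
  have := congr1 (fun k => @u Y (k (@t X p))) e => /=.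
  by rewrite !tK.
have hk := gamma_hom_comp (gamma_hom_comp (u_hom Y) hg) (t_hom X).
have [f [hf fE]] := gamma_map_full hk.
exists (exist _ f hf); apply: eq_exist; apply/funext=> x /=.
by rewrite fE /= !uK.
Qed.

End GammaFunctor.

(** * Transport of structures *)

Section TransportStructures.

Variables (F : fieldType) (S T : Type) (f : S -> T) (g : T -> S).
Hypotheses (fK : cancel f g) (gK : cancel g f).

Definition transport_M2 (B : M2_algebra F S) : M2_algebra F T.
Proof.
refine (@M2Algebra F T (transport_algebra fK gK B)
  (transport_alternative fK gK (M2_alternative B)) (f \o M2_phi B) _).
by apply: hom_comp (M2_phi_hom B); apply: transport_hom.
Defined.

Lemma transport_M2_hom B : is_M2_hom B (transport_M2 B) f.
Proof. by split; first exact: transport_hom. Qed.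

Definition transport_gamma (G : gamma_algebra F S) : gamma_algebra F T.
Proof.
pose h := hom_inv (transport_hom fK gK G) fK gK.
pose h0 := hom0 h; pose hE := (homD h, homZ h, homM h, homN h, hom1 h, h0).
pose gI := can_inj gK.
refine (@GammaAlgebra F T (transport_algebra fK gK G)
  (fun i x => gpart G i (g x)) _ _ _ _ _ _ _ _ _ _ _ _).
- move=> i; have [s0 sD sZ] := gpart_subspace G i.
  by split=> [|x y|a x]; rewrite hE; [|apply: sD|apply: sZ].
- move=> x; have [x0 [x1 [p0 [p1 e]]]] := gpart_sum G (g x).
  by exists (f x0), (f x1); rewrite !fK; do !split=> //; apply: gI; rewrite hE !fK.
- by move=> x p0 p1; apply: gI; rewrite h0; apply: (@gpart_direct _ _ G).
- by move=> i j x y px py; rewrite hE; apply: gpart_mul.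
- by rewrite hE; apply: gamma_even1.
- move=> a b c pa pb pc; apply: gI; rewrite /associator /asub !hE.
  exact: (@gamma_even_assoc _ _ G).
- move=> a x pa px; apply: gI; rewrite /commutator /asub !hE.
  exact: (@gamma_even_odd_comm _ _ G).
- move=> a x y pa; apply: gI; rewrite /associator /asub !hE.
  exact: (@gamma_even_nucl _ _ G).
- move=> x y px py; have [c0 [c1 c2]] := gamma_odd_center px py.
  split; first by rewrite hE.
  split=> [z pz|z t pz pt].
    by apply: gI; rewrite /commutator /asub !hE; apply: c1.
  have [a1 [a2 a3]] := c2 _ _ pz pt.
  by split; [|split]; apply: gI; rewrite /associator /asub !hE.
- by move=> x y px py; apply: gI; rewrite !hE; apply: (@gamma_odd_skew _ _ G).
- by move=> c2 x px; apply: gI; rewrite !hE; apply: (@gamma_odd_alt _ _ G).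
- by move=> x y z px py pz; apply: gI; rewrite !hE; apply: (@gamma_odd_cyclic _ _ G).
Defined.

Lemma transport_gamma_hom G : is_gamma_hom G (transport_gamma G) f.
Proof. by split; [exact: (transport_hom fK gK G)|move=> i x /=; rewrite fK]. Qed.

End TransportStructures.

Lemma M2_rigid (F : fieldType) (T : Type) (B C : M2_algebra F T) :
  is_M2_hom B C id -> B = C.
Proof.
case: B C => [A altA phi phiP] [A' altA' phi' phiP'] [/= h e].
have AA := algebra_rigid h; subst A'; have pp : phi = phi' := e; subst phi'.
by f_equal; apply: Prop_irrelevance.
Qed.

Lemma gamma_rigid (F : fieldType) (T : Type) (G H : gamma_algebra F T) :
  is_gamma_hom G H id -> is_gamma_hom H G id -> G = H.
Proof.
case: G H => [A p ? ? ? ? ? ? ? ? ? ? ? ?] [A' p' ? ? ? ? ? ? ? ? ? ? ? ?].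
move=> [/= h e] [/= _ e'].
have AA := algebra_rigid h; subst A'.
have pp : p = p'.
  by apply/funext=> i; apply/funext=> x; apply/propext; split; [apply: e|apply: e'].
by subst p'; f_equal; apply: Prop_irrelevance.
Qed.

Section InUniverse.

Variables (F : fieldType) (U : Type).

Local Notation M2_obj := (M2_object F (fun X : set U => set_type X)).
Local Notation gamma_obj := (gamma_object F (fun X : set U => set_type X)).

Definition M2_emb (S : Type) (B : M2_algebra F S) (e : S -> U)
  (X : M2_obj) : Prop :=
  exists m, [/\ is_M2_hom B X m, bijective m & forall x, val (m x) = e x].

Definition gamma_emb (S : Type) (G : gamma_algebra F S) (e : S -> U)
  (X : gamma_obj) : Prop :=
  exists m, [/\ is_gamma_hom G X m, bijective m & forall x, val (m x) = e x].

Lemma range_bijection (S : Type) (e : S -> U) : injective e ->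
  exists m : S -> set_type (range e), bijective m /\ forall x, val (m x) = e x.
Proof.
move=> eI; exists (fun x => exist _ (e x) (mem_set (imageT e x))); split=> //.
apply: injective_surjective_bijective => [x y [] /eI //|[y Yy]].
by have [x _ xy] := set_mem Yy; exists x; apply: val_inj.
Qed.

Lemma M2_emb_exists (S : Type) (B : M2_algebra F S) (e : S -> U) : injective e ->
  exists X, M2_emb B e X /\ M2_index X = range e.
Proof.
move=> /range_bijection[m [[k mK kK] me]].
exists (@M2Object _ _ (fun X : set U => set_type X) (range e)
  (transport_M2 mK kK B)).
by split=> //; exists m; split=> //; [apply: transport_M2_hom|exists k].
Qed.

Lemma gamma_emb_exists (S : Type) (G : gamma_algebra F S) (e : S -> U) :
  injective e ->
  exists X, gamma_emb G e X /\ gamma_index X = range e.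
Proof.
move=> /range_bijection[m [[k mK kK] me]].
exists (@GammaObject _ _ (fun X : set U => set_type X) (range e)
  (transport_gamma mK kK G)).
by split=> //; exists m; split=> //; [apply: transport_gamma_hom|exists k].
Qed.

Lemma val_bij_range (S : Type) (e : S -> U) (X : set U) (m : S -> set_type X) :
  bijective m -> (forall x, val (m x) = e x) -> X = range e.
Proof.
move=> [k mK kK] me; apply/seteqP; split=> [u Xu|_ [x _ <-]].
  by exists (k (exist _ u (mem_set Xu))) => //; rewrite -me kK.
by rewrite -me; apply: set_valP.
Qed.

Lemma M2_emb_unique (S : Type) (B : M2_algebra F S) (e : S -> U) X Y :
  M2_emb B e X -> M2_emb B e Y -> X = Y.
Proof.
case: X Y => [X C] [Y D] [m [mh mb me]] [n [nh nb ne]].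
rewrite /= in m n mh mb me nh nb ne.
have XY : X = Y by rewrite (val_bij_range mb me) (val_bij_range nb ne).
subst Y; have mn : m = n.
  by apply/funext=> x; apply: val_inj; exact: (etrans (me x) (esym (ne x))).
subst n; congr M2Object; apply: M2_rigid; case: mb => k mK kK.
have := M2_hom_comp nh (M2_hom_inv mh mK kK).
by have -> : m \o k = id by apply/funext.
Qed.

Lemma gamma_emb_unique (S : Type) (G : gamma_algebra F S) (e : S -> U) X Y :
  gamma_emb G e X -> gamma_emb G e Y -> X = Y.
Proof.
case: X Y => [X C] [Y D] [m [mh mb me]] [n [nh nb ne]].
rewrite /= in m n mh mb me nh nb ne.
have XY : X = Y by rewrite (val_bij_range mb me) (val_bij_range nb ne).
subst Y; have mn : m = n.
  by apply/funext=> x; apply: val_inj; exact: (etrans (me x) (esym (ne x))).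
subst n; congr GammaObject; case: mb => k mK kK.
have mk : m \o k = id by apply/funext.
have h1 := gamma_hom_comp nh (gamma_hom_inv mh mK kK).
have h2 := gamma_hom_comp mh (gamma_hom_inv nh mK kK).
by rewrite mk in h1 h2; apply: gamma_rigid.
Qed.

End InUniverse.

(** * Comparison of the categories *)

Section Correspondence.

Variable F : fieldType.

Lemma gamma_of_isomorphic (S T : Type) (B : M2_algebra F S) (C : M2_algebra F T) m :
  is_M2_hom B C m -> bijective m -> gamma_isomorphic (gamma_of B) (gamma_of C).
Proof.
move=> hm [k mK kK]; have hk := M2_hom_inv hm mK kK.
exists (gamma_map hm); first exact: gamma_map_hom.
by exists (gamma_map hk) => p; apply: gpair_inj; rewrite !(gfst_map, gsnd_map) ?mK ?kK.
Qed.

Lemma six_injection (T : Type) (j : T * T -> T) : injective j ->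
  exists f : six T -> T, injective f.
Proof.
move=> jI; exists (fun s => j (j (j s.1.1, j s.1.2), j s.2)).
move=> [[[a b] [c d]] [x y]] [[[a' b'] [c' d']] [x' y']] /=.
by move=> /jI[/jI[/jI[-> ->] /jI[-> ->]] /jI[-> ->]].
Qed.

(** The alternative algebra embeds into the sixth power of its Gamma-algebra
    by coordinatization, and the Gamma-algebra into the square of the algebra
    by construction. *)
Lemma gamma_of_card (S T : Type) (B : M2_algebra F S) (G : gamma_algebra F T) :
  gamma_isomorphic (gamma_of B) G ->
  (finite_set [set: S] /\ finite_set [set: T]) \/ exists b : S -> T, bijective b.
Proof.
move=> [m _ [k mK kK]].
have kI : injective (fun t => sval (k t)) by move=> x y /val_inj_sig/(can_inj kK).
have [c cK Kc] := coordinatize_bij B.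
pose s (u : S) : six T := six_map m (sval (c u)).
have sI : injective s.
  move=> u v; rewrite /s => e; apply: (can_inj Kc); apply: val_inj_sig.
  case: (sval (c u)) (sval (c v)) e => [[[? ?] [? ?]] [? ?]] [[[? ?] [? ?]] [? ?]].
  by case; do 6!move=> /(can_inj mK) ->.
have [finS|infS] := pselect (finite_set [set: S]).
  left; split=> //; exact: injective_finite kI (square_finite finS).
have infT : infinite_set [set: T].
  move=> finT; apply: infS; apply: injective_finite sI _.
  have finT2 := square_finite finT.
  by rewrite -setXTT; apply: finite_setX => //; apply: square_finite.
have [j jI] := square_injection infS; have [j' jI'] := square_injection infT.
have [f fI] := six_injection jI'.
right; have [b bb _] := schroeder_bernstein (inj_comp fI sI) (inj_comp jI kI).
by exists b.
Qed.

Lemma gamma_algebras_equivalent : equivalent_categories (M2_algebras F) (gamma_algebras F).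
Proof.
pose El (T : Type) := T.
pose o (X : M2_object F El) : gamma_object F El :=
  @GammaObject F Type El (gamma_carrier X) (gamma_of X).
have oP (X : M2_object F El) : gamma_isomorphic (gamma_of X) (gamma_str (o X)).
  by exists id => //; exists id.
pose K := @gamma_functor F Type Type El El o oP.
pose p (G : gamma_object F El) : M2_object F El :=
  @M2Object F Type El (zorn_carrier G) (zorn_M2 G).
have iso (G : gamma_object F El) :
    {t : gamma_hom (o (p G)) G * gamma_hom G (o (p G)) |
      cancel (sval t.1) (sval t.2) /\ cancel (sval t.2) (sval t.1)}.
  apply: cid; have [f hf [g fK gK]] := recover_isomorphic G.
  by exists (exist _ f hf, exist _ g (gamma_hom_inv hf fK gK)).
apply: (@equivalence_of_ff_eso _ _ K p (fun G => (sval (iso G)).1)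
  (fun G => (sval (iso G)).2)) => [X Y|G|G].
- exact: gamma_functor_ff.
- by case: (iso G) => t [h1 h2]; apply: eq_exist; apply/funext.
- by case: (iso G) => t [h1 h2]; apply: eq_exist; apply/funext.
Qed.

(** A bijection on objects within the correspondence of isomorphism classes, and
    the functor it determines. *)
Lemma gamma_algebras_isomorphic (U : Type) : infinite_set [set: U] ->
  isomorphic_categories (M2_algebras_in F U) (gamma_algebras_in F U).
Proof.
move=> infU; have [j jI] := square_injection infU.
have [j6 j6I] := six_injection jI.
pose El (X : set U) : Type := set_type X.
pose M2o := M2_object F El; pose Go := gamma_object F El.
pose R (X : M2o) (G : Go) := gamma_isomorphic (gamma_of X) (gamma_str G).
have vI (X : set U) : injective (fun x : set_type X => val x) by exact: val_inj.
have sym := gamma_isomorphic_sym; have tr := gamma_isomorphic_trans.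
have R_M2 X Y G : R X G -> R Y G -> exists e, M2_emb (M2_str X) e Y.
  move=> XG YG.
  have [m hm bm] := gamma_of_reflects (tr _ _ _ _ _ _ _ XG (sym _ _ _ _ _ YG)).
  by exists (fun x => val (m x)), m.
have R_gamma X G H : R X G -> R X H -> exists e, gamma_emb (gamma_str G) e H.
  move=> XG XH; have [m hm bm] := tr _ _ _ _ _ _ _ (sym _ _ _ _ _ XG) XH.
  by exists (fun x => val (m x)), m.
have [i [iI iR]] : exists i : M2o -> Go, injective i /\ forall X, R X (i X).
  apply: (@object_injection U infU M2o Go
    (fun X => El (M2_index X)) (fun G => El (gamma_index G))
    (fun G x => val x) (fun G => azero G) (fun G => gamma_index G)
    (fun X e Y => M2_emb (M2_str X) e Y)
    (fun G e H => gamma_emb (gamma_str G) e H)).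
  - by move=> G; apply: vI.
  - move=> X.
    have [|G [[m [hm bm _]] _]] := @gamma_emb_exists F U _ (gamma_of X)
        (fun p => j (val (sval p).1, val (sval p).2)).
      by move=> p q /jI[/vI e1 /vI e2]; apply: gpair_inj.
    by exists G; exists m.
  - move=> X X' G G' XG X'G X'G'.
    by apply: tr XG (tr _ _ _ _ _ _ _ (sym _ _ _ _ _ X'G) X'G').
  - exact: R_M2.
  - by move=> X G e H XG [m [hm bm _]]; apply: tr XG _; exists m.
  - by move=> X e Y Y'; apply: M2_emb_unique.
  - by move=> G e; apply: gamma_emb_exists.
  - move=> X G /gamma_of_card[[finX _]|[b [k bK kK]]]; [by left|right].
    by exists k => x; exists (b x).
have [i' [iI' iR']] : exists i : Go -> M2o, injective i /\ forall G, R (i G) G.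
  apply: (@object_injection U infU Go M2o
    (fun G => El (gamma_index G)) (fun X => El (M2_index X))
    (fun G x => val x) (fun X => azero X) (fun X => M2_index X)
    (fun G e H => gamma_emb (gamma_str G) e H)
    (fun X e Y => M2_emb (M2_str X) e Y) (fun G X => R X G)).
  - by move=> G; apply: vI.
  - move=> G.
    have [|X [[m [hm bm _]] _]] := @M2_emb_exists F U _ (zorn_M2 G)
        (fun s => j6 (six_map val (sval s))).
      move=> s t /j6I.
      case: s t => [[[[a b] [c d]] [x y]] ps] [[[[a' b'] [c' d']] [x' y']] pt] e.
      by apply: val_inj_sig; case: e => /= /vI-> /vI-> /vI-> /vI-> /vI-> /vI->.
    exists X; apply: tr (recover_isomorphic G); apply: sym.
    exact: gamma_of_isomorphic hm bm.
  - move=> G G' X X' XG XG' X'G'.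
    by apply: tr X'G' (tr _ _ _ _ _ _ _ (sym _ _ _ _ _ XG') XG).
  - by move=> G H X; apply: R_gamma.
  - move=> G X e Y XG [m [hm bm _]]; apply: tr XG; apply: sym.
    exact: gamma_of_isomorphic hm bm.
  - by move=> G e H H'; apply: gamma_emb_unique.
  - by move=> X e; apply: M2_emb_exists.
  - move=> G X /gamma_of_card[[_ finG]|[b [k bK kK]]]; [by left|right].
    by exists b => x; exists (k x).
have [o bo oE] := schroeder_bernstein iI iI'.
have oP X : R X (o X) by case: (oE X) => [->|{1}<-].
exists (@gamma_functor F _ _ El El o oP); split=> // X Y.
exact: gamma_functor_ff.
Qed.

End Correspondence.

Theorem theorem4 (F : fieldType) :
  equivalent_categories (M2_algebras F) (gamma_algebras F) /\
  (forall U : Type, infinite_set [set: U] ->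
     isomorphic_categories (M2_algebras_in F U) (gamma_algebras_in F U)).
Proof.
split; first exact: gamma_algebras_equivalent.
exact: gamma_algebras_isomorphic.
Qed.
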